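(* Let $K$ be a field and let $\mathbb{X}\subseteq\mathbb{P}^n_K$ be a $0$-dimensional locally Gorenstein scheme with support $\mathrm{Supp}(\mathbb{X})=\{p_1,\dots,p_s\}$, no $p_j$ lying on the hyperplane $X_0=0$. Let $\sigma$ be a homogeneous trace map of degree zero of $Q^h(R)/L_0$. For $j=1,\dots,s$ let $\nu_j=\dim_K\mathcal{O}_{\mathbb{X},p_j}$, let $I_j$ be the homogeneous vanishing ideal of $\mathbb{X}$ at $p_j$, and let $\mathbb{Y}_j$ be the subscheme of $\mathbb{X}$ defined by $I_{\mathbb{Y}_j}=\bigcap_{k\ne j}I_k$. Then the formula $$\mathfrak{F}_{\widetilde R/R}\cdot\mathfrak{C}^\sigma_{\mathbb{X}}=\widetilde R$$ holds true if one of the following conditions is satisfied: (a) The scheme $\mathbb{X}$ is a Cayley-Bacharach scheme. (b) For all $j\in\{1,\dots,s\}$, the Hilbert function of $\mathbb{Y}_j$ is of the form $$\mathrm{HF}_{\mathbb{Y}_j}(i)=\begin{cases}\mathrm{HF}_{\mathbb{X}}(i)&\text{if } i<\alpha_{\mathbb{Y}_j/\mathbb{X}},\\ \mathrm{HF}_{\mathbb{X}}(i)-\nu_j&\text{if } i\ge\alpha_{\mathbb{Y}_j/\mathbb{X}},\end{cases}$$ where $\alpha_{\mathbb{Y}_j/\mathbb{X}}=\min\{i\in\mathbb{N}\mid(I_{\mathbb{Y}_j/\mathbb{X}})_i\ne\langle0\rangle\}$.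
   Context: Setting. $P=K[X_0,\dots,X_n]$ has the standard grading, $I_{\mathbb{X}}\subseteq P$ is the (saturated) homogeneous vanishing ideal of $\mathbb{X}$, $R=P/I_{\mathbb{X}}$, and $\mathrm{Supp}(\mathbb{X})$ is the set of closed points. The residue class $x_0$ of $X_0$ in $R$ is a non-zerodivisor. The homogeneous vanishing ideal $I_j$ of $\mathbb{X}$ at $p_j$ is the primary component of $I_{\mathbb{X}}$ belonging to $p_j$, so $I_{\mathbb{X}}=\bigcap_jI_j$. $\mathcal{O}_{\mathbb{X},p_j}$ is the local ring at $p_j$, with residue field $\kappa(p_j)$; $\varkappa_j=\dim_K\kappa(p_j)$; $\deg(\mathbb{X})=\sum_j\dim_K\mathcal{O}_{\mathbb{X},p_j}$. For a subscheme $\mathbb{Y}\subseteq\mathbb{X}$, $I_{\mathbb{Y}/\mathbb{X}}\subseteq R$ is the ideal of $\mathbb{Y}$ in $R$ and $\mathrm{HF}_{\mathbb{Y}}$ is the Hilbert function of $P/I_{\mathbb{Y}}$. $r_{\mathbb{X}}$ is the least integer such that $\mathrm{HF}_{\mathbb{X}}(i)=\deg(\mathbb{X})$ for all $i\ge r_{\mathbb{X}}$. $\mathbb{X}$ is locally Gorenstein if every $\mathcal{O}_{\mathbb{X},p_j}$ is a Gorenstein ring. $Q^h(R)$ is the localization of $R$ at all homogeneous non-zerodivisors; $Q^h(R)=R_{x_0}\cong\prod_{j=1}^s\mathcal{O}_{\mathbb{X},p_j}[T_j,T_j^{-1}]$ with $\deg T_j=1$, via the injection $\tilde\imath:R\to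 Q^h(R)$, $\tilde\imath(f)=(f_{p_1}T_1^i,\dots,f_{p_s}T_s^i)$ for $f\in R_i$, where $f_{p_j}$ is the germ of $f$ at $p_j$ (the image of $f/x_0^i$ in $\mathcal{O}_{\mathbb{X},p_j}$). Conductor. $\widetilde R=\prod_{j=1}^s\mathcal{O}_{\mathbb{X},p_j}[T_j]$, which contains $R$ via $\tilde\imath$, and $\mathfrak{F}_{\widetilde R/R}=\{f\in\widetilde R\mid f\widetilde R\subseteq R\}$. Complementary module. $L_0=K[x_0,x_0^{-1}]$. A homogeneous trace map of degree zero of $Q^h(R)/L_0$ is a homogeneous element $\sigma$ of degree $0$ of the graded module $\underline{\mathrm{Hom}}_{L_0}(Q^h(R),L_0)$ which is a $Q^h(R)$-basis of it; it exists when $\mathbb{X}$ is locally Gorenstein. The Dedekind complementary module $\mathfrak{C}^\sigma_{\mathbb{X}}\subseteq Q^h(R)$ is the image of the injection $\underline{\mathrm{Hom}}_{K[x_0]}(R,K[x_0])\to\underline{\mathrm{Hom}}_{L_0}(Q^h(R),L_0)=Q^h(R)\sigma\cong Q^h(R)$, $\varphi\mapsto\varphi\otimes\mathrm{id}_{L_0}$ (the last isomorphism sending $g\sigma$ to $g$). The product $\mathfrak{F}_{\widetilde R/R}\cdot\mathfrak{C}^\sigma_{\mathbb{X}}$ is the $R$-submodule of $Q^h(R)$ generated by products of elements. Cayley-Bacharach. A subscheme $\mathbb{Y}\subseteq\mathbb{X}$ is a $p_j$-subscheme if $\mathcal{O}_{\mathbb{Y},p_k}=\mathcal{O}_{\mathbb{X},p_k}$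 for $k\ne j$ and $\mathcal{O}_{\mathbb{X},p_j}\to\mathcal{O}_{\mathbb{Y},p_j}$ is surjective; it is maximal if $\deg(\mathbb{Y})=\deg(\mathbb{X})-\varkappa_j$. Maximal $p_j$-subschemes correspond bijectively to the ideals $\langle s_j\rangle$ of $\mathcal{O}_{\mathbb{X},p_j}$ generated by a nonzero socle element $s_j$ (with $\mathcal{O}_{\mathbb{Y},p_j}=\mathcal{O}_{\mathbb{X},p_j}/\langle s_j\rangle$). For $a\in\mathcal{O}_{\mathbb{X},p_j}$ put $\mu(a)=\min\{i\in\mathbb{N}\mid(0,\dots,0,aT_j^i,0,\dots,0)\in\tilde\imath(R)\}$ (entry in position $j$). If $e_{j1},\dots,e_{j\varkappa_j}\in\mathcal{O}_{\mathbb{X},p_j}$ have residue classes forming a $K$-basis of $\kappa(p_j)$, put $\mu_{\mathbb{Y}/\mathbb{X}}=\max_k\mu(e_{jk}s_j)$ (independent of the choices). $\deg_{\mathbb{X}}(p_j)$ is the minimum of $\mu_{\mathbb{Y}/\mathbb{X}}$ over all maximal $p_j$-subschemes $\mathbb{Y}$; one has $\deg_{\mathbb{X}}(p_j)\le r_{\mathbb{X}}$. $\mathbb{X}$ is a Cayley-Bacharach scheme if $\deg_{\mathbb{X}}(p_j)=r_{\mathbb{X}}$ for all $j$. *)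

(* Defs.v *)
From HB Require Import structures.
From mathcomp Require Import all_boot all_order all_algebra.
From mathcomp Require Import generic_quotient ring_quotient ring.
From mathcomp Require Import boolp classical_sets.
From mathcomp Require Import mpoly.

Set Implicit Arguments.
Unset Strict Implicit.
Unset Printing Implicit Defensive.

Import GRing.Theory.

Local Open Scope classical_set_scope.
Local Open Scope ring_scope.
Local Open Scope quotient_scope.

(* min S; by convention 0 for S empty. *)
Definition nat_min (S : set nat) : nat :=
  xget 0%N [set i | S i /\ forall k, S k -> (i <= k)%N].

Record denominators (A : comNzRingType) := Denominators {
  dens :> {pred A};
  dens1 : 1 \in dens;
  densM : forall a b, a \in dens -> b \in dens -> a * b \in dens;
  dens0 : 0 \notin dens }.

Section Localization.
Variables (A : comNzRingType) (S : denominators A).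

Record lratio := LRatio { lratio_val : A * A; _ : lratio_val.2 \in S }.
HB.instance Definition _ := [isSub for lratio_val].
HB.instance Definition _ := [Choice of lratio by <:].

Local Notation num x := (lratio_val x).1.
Local Notation den x := (lratio_val x).2.

Lemma denP (x : lratio) : den x \in S. Proof. by case: x. Qed.

Definition lratio_equiv (x y : lratio) : bool :=
  `[< exists2 u, u \in S & u * (num x * den y - num y * den x) = 0 >].

Lemma lratio_equivP x y : reflect
  (exists2 u, u \in S & u * (num x * den y - num y * den x) = 0)
  (lratio_equiv x y).
Proof. exact: asboolP. Qed.

Lemma lratio_equiv_refl x : lratio_equiv x x.
Proof.
by apply/lratio_equivP; exists 1; rewrite ?dens1 // subrr mulr0.
Qed.

Lemma lratio_equiv_sym x y : lratio_equiv x y = lratio_equiv y x.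
Proof.
by apply/lratio_equivP/lratio_equivP => -[u uS e]; exists u => //;
  rewrite -opprB mulrN e oppr0.
Qed.

Lemma lratio_equiv_trans y x z :
  lratio_equiv x y -> lratio_equiv y z -> lratio_equiv x z.
Proof.
move=> /lratio_equivP[u uS eu] /lratio_equivP[v vS ev].
apply/lratio_equivP; exists (u * v * den y); first by rewrite !densM ?denP.
have -> : u * v * den y * (num x * den z - num z * den x) =
   v * den z * (u * (num x * den y - num y * den x)) +
   u * den x * (v * (num y * den z - num z * den y)) by ring.
by rewrite eu ev !mulr0 addr0.
Qed.

Canonical lratio_equivr := EquivRel lratio_equiv lratio_equiv_refl
  lratio_equiv_sym lratio_equiv_trans.

Definition loc : Type := {eq_quot lratio_equiv}.
HB.instance Definition _ : EqQuotient _ lratio_equiv loc := EqQuotient.on loc.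
HB.instance Definition _ := Choice.on loc.

Lemma loc_eqP (x y : lratio) : reflect
  (exists2 u, u \in S & u * (num x * den y - num y * den x) = 0)
  (\pi_loc x == \pi_loc y).
Proof. by rewrite eqmodE; apply: lratio_equivP. Qed.

Definition addr_lratio (x y : lratio) : lratio :=
  @LRatio (num x * den y + num y * den x, den x * den y)
         (densM (denP x) (denP y)).
Definition oppr_lratio (x : lratio) : lratio := @LRatio (- num x, den x) (denP x).
Definition mulr_lratio (x y : lratio) : lratio :=
  @LRatio (num x * num y, den x * den y) (densM (denP x) (denP y)).
Definition lratio_of (a : A) : lratio := @LRatio (a, 1) (dens1 S).

Definition addl := lift_op2 loc addr_lratio.
Definition oppl := lift_op1 loc oppr_lratio.
Definition mull := lift_op2 loc mulr_lratio.
Definition zerol := lift_cst loc (lratio_of 0).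
Definition onel := lift_cst loc (lratio_of 1).

Lemma repr_loc (x : lratio) : exists2 u, u \in S &
  u * (num (repr (\pi_loc x)) * den x - num x * den (repr (\pi_loc x))) = 0.
Proof. by apply/loc_eqP; rewrite reprK. Qed.

Lemma pi_addl : {morph \pi_loc : x y / addr_lratio x y >-> addl x y}.
Proof.
move=> x y; unlock addl; apply/eqP/loc_eqP => /=.
have [u uS eu] := repr_loc x; have [v vS ev] := repr_loc y.
exists (u * v); first by rewrite densM.
set x' := repr _ in eu *; set y' := repr _ in ev *.
have -> : u * v * ((num x * den y + num y * den x) * (den x' * den y')
   - (num x' * den y' + num y' * den x') * (den x * den y)) =
   - (v * den y * den y' * (u * (num x' * den x - num x * den x'))
   + u * den x * den x' * (v * (num y' * den y - num y * den y'))) by ring.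
by rewrite eu ev !mulr0 addr0 oppr0.
Qed.
Canonical pi_addl_morph := PiMorph2 pi_addl.

Lemma pi_oppl : {morph \pi_loc : x / oppr_lratio x >-> oppl x}.
Proof.
move=> x; unlock oppl; apply/eqP/loc_eqP => /=.
have [u uS eu] := repr_loc x; exists u => //.
set x' := repr _ in eu *.
have -> : u * (- num x * den x' - - num x' * den x) =
   u * (num x' * den x - num x * den x') by ring.
exact: eu.
Qed.
Canonical pi_oppl_morph := PiMorph1 pi_oppl.

Lemma pi_mull : {morph \pi_loc : x y / mulr_lratio x y >-> mull x y}.
Proof.
move=> x y; unlock mull; apply/eqP/loc_eqP => /=.
have [u uS eu] := repr_loc x; have [v vS ev] := repr_loc y.
exists (u * v); first by rewrite densM.
set x' := repr _ in eu *; set y' := repr _ in ev *.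
have -> : u * v * (num x * num y * (den x' * den y')
   - num x' * num y' * (den x * den y)) =
   - (v * num y' * den y * (u * (num x' * den x - num x * den x'))
   + u * num x * den x' * (v * (num y' * den y - num y * den y'))) by ring.
by rewrite eu ev !mulr0 addr0 oppr0.
Qed.
Canonical pi_mull_morph := PiMorph2 pi_mull.
Canonical pi_zerol_morph := PiConst zerol.
Canonical pi_onel_morph := PiConst onel.

Local Ltac loc_ring :=
  rewrite ?piE; apply/eqP/loc_eqP; exists 1;
  [exact: dens1 | rewrite /=; ring].

Lemma addlA : associative addl.
Proof.
by move=> x y z; rewrite -[x]reprK -[y]reprK -[z]reprK; loc_ring.
Qed.
Lemma addlC : commutative addl.
Proof. by move=> x y; rewrite -[x]reprK -[y]reprK; loc_ring. Qed.
Lemma add0l : left_id zerol addl.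
Proof. by move=> x; rewrite -[x]reprK; loc_ring. Qed.
Lemma addNl : left_inverse zerol oppl addl.
Proof. by move=> x; rewrite -[x]reprK; loc_ring. Qed.
HB.instance Definition _ := GRing.isZmodule.Build loc addlA addlC add0l addNl.

Lemma mullA : associative mull.
Proof.
by move=> x y z; rewrite -[x]reprK -[y]reprK -[z]reprK; loc_ring.
Qed.
Lemma mullC : commutative mull.
Proof. by move=> x y; rewrite -[x]reprK -[y]reprK; loc_ring. Qed.
Lemma mul1l : left_id onel mull.
Proof. by move=> x; rewrite -[x]reprK; loc_ring. Qed.
Lemma mullDl : left_distributive mull addl.
Proof.
by move=> x y z; rewrite -[x]reprK -[y]reprK -[z]reprK; loc_ring.
Qed.
Lemma onel_neq0 : onel != 0.
Proof.
rewrite (_ : 0 = \pi_loc (lratio_of 0)); last by rewrite piE.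
rewrite [onel](_ : _ = \pi_loc (lratio_of 1)); last by rewrite piE.
apply/negP => /loc_eqP[u uS /=].
by rewrite !mulr1 subr0 mulr1 => u0; move: (dens0 S); rewrite -u0 uS.
Qed.
HB.instance Definition _ := GRing.Zmodule_isComNzRing.Build loc
  mullA mullC mul1l mullDl onel_neq0.

(* [lfrac a b] is a / b; it is only meaningful for b \in S. *)
Definition lfrac (a b : A) : loc := \pi_loc (insubd (lratio_of 0) (a, b)).

Lemma lfracE a b (bS : b \in S) : lfrac a b = \pi_loc (@LRatio (a, b) bS).
Proof.
by rewrite /lfrac; congr (\pi_loc _); apply: val_inj; rewrite insubdK.
Qed.

Lemma lfrac_eqP a b c d : b \in S -> d \in S -> reflect
  (exists2 u, u \in S & u * (a * d - c * b) = 0) (lfrac a b == lfrac c d).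
Proof.
move=> bS dS; rewrite (lfracE a bS) (lfracE c dS).
exact: (loc_eqP (@LRatio (a, b) bS) (@LRatio (c, d) dS)).
Qed.

Lemma lfracM a b c d : b \in S -> d \in S ->
  lfrac a b * lfrac c d = lfrac (a * c) (b * d).
Proof.
move=> bS dS; rewrite (lfracE _ bS) (lfracE _ dS) (lfracE _ (densM bS dS)).
rewrite [LHS](_ : _ = mull (\pi_loc (@LRatio (a, b) bS))
                           (\pi_loc (@LRatio (c, d) dS))) // !piE.
by congr (\pi_loc _); apply: val_inj.
Qed.

Lemma lfracB a b c d : b \in S -> d \in S ->
  lfrac a b - lfrac c d = lfrac (a * d - c * b) (b * d).
Proof.
move=> bS dS; rewrite (lfracE _ bS) (lfracE _ dS) (lfracE _ (densM bS dS)).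
rewrite [LHS](_ : _ = addl (\pi_loc (@LRatio (a, b) bS))
                           (oppl (\pi_loc (@LRatio (c, d) dS)))) // !piE.
by congr (\pi_loc _); apply: val_inj; rewrite /= mulNr.
Qed.

Lemma lfrac11 : lfrac 1 1 = 1.
Proof.
rewrite (lfracE _ (dens1 S)) [RHS](_ : _ = onel) // !piE.
by congr (\pi_loc _); apply: val_inj.
Qed.

End Localization.

(* [e] is a family of elements of [V] whose residue classes form a basis of
   V / W over the field [K], which acts on the ring [A] through [c]. *)
Definition basis_mod (K : fieldType) (A : comNzRingType) (c : K -> A)
    (V W : set A) (d : nat) (e : 'I_d -> A) : Prop :=
  (forall i, V (e i)) /\
  forall v, V v -> exists! a : {ffun 'I_d -> K},
    W (v - \sum_(i < d) c (a i) * e i).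

(* dim_K (V / W); only used when this dimension is finite. *)
Definition dim_mod (K : fieldType) (A : comNzRingType) (c : K -> A)
    (V W : set A) : nat :=
  xget 0%N [set d | exists e : 'I_d -> A, basis_mod c V W e].

Definition is_ideal (A : comNzRingType) (J : {pred A}) : Prop :=
  0 \in J /\ forall a, {in J &, forall u v, a * u + v \in J}.

Definition primary (A : comNzRingType) (J : idealr A) : Prop :=
  forall f g, f * g \in J -> f \in J \/ exists k, g ^+ k \in J.

Definition noetherian (A : comNzRingType) : Prop :=
  forall J : {pred A}, is_ideal J -> exists (d : nat) (g : 'I_d -> A),
    forall x, x \in J <-> exists c : 'I_d -> A, x = \sum_i c i * g i.

Definition injective_module (A : comNzRingType) (E : lmodType A) : Prop :=
  forall (M N : lmodType A) (i : {linear M -> N}) (f : {linear M -> E}),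
    injective i -> exists g : {linear N -> E}, forall x, g (i x) = f x.

(* Injective dimension at most [d], by dimension shifting along an embedding
   0 -> M -> E -> N -> 0 into an injective module. *)
Fixpoint injdim_le (A : comNzRingType) (d : nat) (M : lmodType A) : Prop :=
  if d is d'.+1 then
    exists (E N : lmodType A) (f : {linear M -> E}) (g : {linear E -> N}),
      [/\ injective_module E, injective f,
          (forall y, exists x, g x = y),
          (forall x, g x = 0 <-> exists z, x = f z)
        & injdim_le d' N]
  else injective_module M.

(* For a local ring [A]: Noetherian of finite injective dimension over itself. *)
Definition gorenstein_local (A : comNzRingType) : Prop :=
  noetherian A /\ exists d, injdim_le d (A^o : lmodType A).

Section GradedHom.
(* The graded module underline-Hom_L(A, L) for a graded ring [A] with
   homogeneous components [gr i] and a graded subring [L]. *)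
Variables (A : comNzRingType) (gr : int -> set A) (L : set A).

Definition lin_to (phi : A -> A) : Prop :=
  (forall x, L (phi x)) /\
  (forall a x y, L a -> phi (a * x + y) = a * phi x + phi y).

Definition homog_lin_to (d : int) (phi : A -> A) : Prop :=
  lin_to phi /\ forall i x, gr i x -> gr (i + d) (phi x).

Definition graded_hom (phi : A -> A) : Prop :=
  exists (m : nat) (d : 'I_m -> int) (f : 'I_m -> A -> A),
    (forall k, homog_lin_to (d k) (f k)) /\
    (forall x, phi x = \sum_(k < m) f k x).
End GradedHom.

(* A closed subscheme of P^n_K is given by its vanishing ideal, a saturated
   homogeneous ideal of K[X_0,...,X_n]. *)

Section ProjectiveScheme.
Variables (K : fieldType) (n : nat).
Local Notation P := {mpoly K[n.+1]}.

Definition homog_ideal (J : {pred P}) : Prop :=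
  forall d f, f \in J -> pihomog mdeg d f \in J.

Definition saturated (J : {pred P}) : Prop :=
  forall f, (exists k, forall m : 'X_{1..n.+1}, mdeg m = k -> 'X_[m] * f \in J) ->
    f \in J.

(* The Hilbert function of P / J. *)
Definition HF (J : {pred P}) (i : nat) : nat :=
  dim_mod (@mpolyC n.+1 K) [set f : P | f \is i.-homog] [set f : P | f \in J].

Section Scheme.
Variable I : idealr P.
Local Notation R := {ideal_quot I}.

(* The points of Proj (P / I). *)
Record projPoint := ProjPoint {
  pt :> prime_idealr P;
  pt_homog : homog_ideal pt;
  pt_sub : forall f, f \in I -> f \in pt;
  pt_relevant : exists i, ('X_i : P) \notin pt }.

Definition closed_point (x : projPoint) : Prop :=
  forall y : projPoint, {subset x <= y} -> {subset y <= x}.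

(* The topological space Proj (P / I) is non-empty of dimension 0: there are no
   proper specializations. *)
Definition zero_dimensional : Prop :=
  (exists x : projPoint, True) /\ forall x, closed_point x.

Definition enumerates_support (s : nat) (p : 'I_s -> projPoint) : Prop :=
  [/\ forall j, closed_point (p j),
      forall j k, p j =i p k -> j = k
    & forall x, closed_point x -> exists j, x =i p j].

Definition Rhom (i : nat) : set R :=
  [set r | exists2 f : P, f \is i.-homog & r = \pi_R f].

Definition Rgr (i : int) : set R :=
  match i with Posz m => Rhom m | Negz _ => [set 0] end.

Definition hcomp (i : nat) (r : R) : R := \pi_R (pihomog mdeg i (repr r)).

Definition x0 : R := \pi_R ('X_ord0).

Definition constR (c : K) : R := \pi_R (c%:MP).

Lemma pi_eq0 (f : P) : (\pi_R f == 0) = (f \in I).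
Proof. by rewrite -[0](rmorph0 \pi_R) -Quotient.idealrBE subr0. Qed.

Lemma Rhom1 : Rhom 0 1.
Proof. by exists 1; [exact: dhomog1 | rewrite rmorph1]. Qed.

Lemma RhomM i j a b : Rhom i a -> Rhom j b -> Rhom (i + j) (a * b).
Proof.
move=> [f hf ->] [g hg ->]; exists (f * g); first exact: dhomogM.
by rewrite rmorphM.
Qed.

Lemma RhomB i a b : Rhom i a -> Rhom i b -> Rhom i (a - b).
Proof.
move=> [f hf ->] [g hg ->]; exists (f - g); last by rewrite rmorphB.
by rewrite rpredB.
Qed.

Section LocalRing.
Variable x : projPoint.

Definition Rout : {pred R} :=
  fun r => `[< exists (d : nat) (f : P),
                 [/\ f \is d.-homog, f \notin x & r = \pi_R f] >].

Lemma Rout1 : 1 \in Rout.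
Proof.
apply/asboolP; exists 0%N, 1; split; [exact: dhomog1 | | by rewrite rmorph1].
by rewrite idealr1.
Qed.

Lemma RoutM a b : a \in Rout -> b \in Rout -> a * b \in Rout.
Proof.
move=> /asboolP[d [f [hf xf ->]]] /asboolP[e [g [hg xg ->]]].
apply/asboolP; exists (d + e)%N, (f * g); split; last by rewrite rmorphM.
  exact: dhomogM.
by rewrite prime_idealrM negb_or xf.
Qed.

Lemma Rout0 : 0 \notin Rout.
Proof.
apply/negP => /asboolP[d [f [hf /negP xf /esym/eqP]]].
by rewrite pi_eq0 => /pt_sub.
Qed.

Definition dens_at : denominators R := Denominators Rout1 RoutM Rout0.

Definition deg0_pred : {pred loc dens_at} :=
  fun q => `[< exists (d : nat) (a b : R),
                 [/\ Rhom d a, Rhom d b, b \in dens_at & q = lfrac dens_at a b] >].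

Lemma deg0_subring : subring_closed deg0_pred.
Proof.
split.
- apply/asboolP; exists 0%N, 1, 1; split; try exact: Rhom1.
    exact: dens1.
  by rewrite lfrac11.
- move=> q q' /asboolP[d [a [b [ha hb bS ->]]]].
  move=> /asboolP[d' [a' [b' [ha' hb' bS' ->]]]].
  apply/asboolP; exists (d + d')%N, (a * b' - a' * b), (b * b').
  split; [ | exact: RhomM | exact: densM | by rewrite lfracB].
  by apply: RhomB; [exact: RhomM | rewrite addnC; exact: RhomM].
- move=> q q' /asboolP[d [a [b [ha hb bS ->]]]].
  move=> /asboolP[d' [a' [b' [ha' hb' bS' ->]]]].
  apply/asboolP; exists (d + d')%N, (a * a'), (b * b').
  by split; [exact: RhomM | exact: RhomM | exact: densM | rewrite lfracM].
Qed.

HB.instance Definition _ :=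
  GRing.isSubringClosed.Build (loc dens_at) deg0_pred deg0_subring.

(* The local ring at [x], as the degree 0 part of the homogeneous localization. *)
Record localRing := LocalRing {
  lval : loc dens_at; _ : lval \in deg0_pred }.
HB.instance Definition _ := [isSub for lval].
HB.instance Definition _ := [Choice of localRing by <:].
HB.instance Definition _ :=
  [SubChoice_isSubComNzRing of localRing by <:].

(* The germ at [x] of an element [r] of degree [i], that is r / x_0^i;
   meaningful when X_0 does not vanish at [x]. *)
Definition germ (i : nat) (r : R) : localRing :=
  insubd 0 (lfrac dens_at r (x0 ^+ i)).

Definition constO (c : K) : localRing := germ 0 (constR c).

Definition maxO : set localRing := [set a | ~ exists b, a * b = 1].

(* nu = dim_K O, kappa = dim_K (O / m) *)
Definition nu : nat := dim_mod constO setT [set 0].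
Definition kappa : nat := dim_mod constO setT maxO.

(* Component at [x] of the injection f |-> (f_{p_j} T_j^i)_j (f in R_i) of R
   into the product of the O_{X,p_j}[T_j]. *)
Definition itilde (r : R) : {poly localRing} :=
  \poly_(i < msize (repr r)) germ i (hcomp i r).

(* The kernel of O_X -> O_Y at [x], for the subscheme Y with ideal J. *)
Definition local_ideal (J : {pred P}) : set localRing :=
  [set a | exists (d : nat) (f g : P),
     [/\ f \is d.-homog, g \is d.-homog, f \in J, g \notin x
       & lval a = lfrac dens_at (\pi_R f) (\pi_R g)]].

Definition socle : set localRing := [set a | forall b, maxO b -> b * a = 0].

End LocalRing.

Arguments constO : clear implicits.
Arguments maxO : clear implicits.
Arguments local_ideal : clear implicits.
Arguments socle : clear implicits.

Definition hnzd : {pred R} :=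
  fun r => `[< (exists d, Rhom d r) /\ forall a, r * a = 0 -> a = 0 >].

Lemma hnzd1 : 1 \in hnzd.
Proof.
by apply/asboolP; split=> [|a]; [exists 0%N; exact: Rhom1 | rewrite mul1r].
Qed.

Lemma hnzdM a b : a \in hnzd -> b \in hnzd -> a * b \in hnzd.
Proof.
move=> /asboolP[[d ha] za] /asboolP[[e hb] zb]; apply/asboolP; split.
  by exists (d + e)%N; exact: RhomM.
by move=> c; rewrite -mulrA => /za /zb.
Qed.

Lemma hnzd0 : 0 \notin hnzd.
Proof.
apply/negP => /asboolP[_ /(_ 1)]; rewrite mul0r => /(_ erefl) /eqP.
by rewrite oner_eq0.
Qed.

Definition dens_h : denominators R := Denominators hnzd1 hnzdM hnzd0.

Local Notation Qh := (loc dens_h).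

Definition fracQ (a b : R) : Qh := lfrac dens_h a b.

Definition Qgr (i : int) : set Qh :=
  [set q | exists (d e : nat) (a b : R),
     [/\ Rhom d a, Rhom e b, b \in hnzd, i = d%:Z - e%:Z & q = fracQ a b]].

(* The subrings K[x_0] of R and L_0 = K[x_0, x_0^-1] of Q^h(R). *)
Definition Kx0 : set R :=
  [set r | exists c : {poly K}, r = \sum_(i < size c) constR c`_i * x0 ^+ i].

Definition L0 : set Qh :=
  [set q | exists (a : R) (k : nat), Kx0 a /\ q = fracQ a (x0 ^+ k)].

(* [sigma] is homogeneous of degree 0 and {sigma} is a basis of the Q^h(R)-module
   Hom_{L_0}(Q^h(R), L_0), where (g sigma)(q) = sigma (g q). *)
Definition trace_map (sigma : Qh -> Qh) : Prop :=
  homog_lin_to Qgr L0 0 sigma /\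
  forall phi, graded_hom Qgr L0 phi ->
    exists! g : Qh, forall q, phi q = sigma (g * q).

(* The g in Q^h(R) such that g sigma is phi (x) id_{L_0} for some phi in
   Hom_{K[x_0]}(R, K[x_0]). *)
Definition dedekind_module (sigma : Qh -> Qh) : set Qh :=
  [set g | exists2 phi : R -> R, graded_hom Rgr Kx0 phi
     & forall r k, sigma (g * fracQ r (x0 ^+ k)) = fracQ (phi r) (x0 ^+ k)].

Section Support.
Variables (s : nat) (p : 'I_s -> projPoint).

(* The ring R~ = prod_j O_j[T_j]. *)
Definition Rtilde : Type := forall j, {poly localRing (p j)}.

(* [h] is the image of q under the extension of [itilde] to Q^h(R). *)
Definition extends_itilde (q : Qh) (h : Rtilde) : Prop :=
  exists a b : R, [/\ b \in hnzd, q = fracQ a b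
    & forall j, itilde (p j) a = itilde (p j) b * h j].

Definition conductor : set Rtilde :=
  [set h | forall g : Rtilde, exists r : R,
     forall j, h j * g j = itilde (p j) r].

(* Subsets of R~ (in particular R~ itself) as subsets of Q^h(R), through the
   isomorphism of Q^h(R) with the product of the O_j[T_j, T_j^-1]. *)
Definition in_Qh (H : set Rtilde) : set Qh :=
  [set q | exists2 h, H h & extends_itilde q h].

Definition submod_prod (F C : set Qh) : set Qh :=
  [set q | exists (m : nat) (r : 'I_m -> R) (f c : 'I_m -> Qh),
     (forall i, F (f i) /\ C (c i)) /\
     q = \sum_(i < m) fracQ (r i) 1 * (f i * c i)].

Definition degX : nat := (\sum_(j < s) nu (p j))%N.

Definition regX : nat :=
  nat_min [set r | forall i, (r <= i)%N -> HF I i = degX].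

Definition subscheme (J : {pred P}) : Prop :=
  [/\ is_ideal J, homog_ideal J, saturated J & {subset I <= J}].

Definition deg_sub (J : {pred P}) : nat :=
  (\sum_(j < s) dim_mod (constO (p j)) setT (local_ideal (p j) J))%N.

(* The maps O_{X,p_k} -> O_{Y,p_k} = O_{X,p_k} / local_ideal (p k) J are
   surjective by construction. *)
Definition max_p_subscheme (j : 'I_s) (J : {pred P}) : Prop :=
  [/\ subscheme J,
      forall k, k != j -> local_ideal (p k) J = [set 0]
    & (deg_sub J + kappa (p j))%N = degX].

Definition mu (j : 'I_s) (a : localRing (p j)) : nat :=
  nat_min [set i | exists r : R, itilde (p j) r = a *: 'X^i /\
                     forall k, k != j -> itilde (p k) r = 0].

(* [m] is mu_{Y/X} for the subscheme Y with ideal J, computed from a generator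
   [t] of the socle ideal defining Y at [p j] and a lift [e] of a basis of the
   residue field. *)
Definition is_mu_sub (j : 'I_s) (J : {pred P}) (m : nat) : Prop :=
  exists (t : localRing (p j)) (e : 'I_(kappa (p j)) -> localRing (p j)),
    [/\ t != 0, socle (p j) t,
        local_ideal (p j) J = [set c * t | c in setT],
        basis_mod (constO (p j)) setT (maxO (p j)) e
      & m = (\max_(k < kappa (p j)) mu (e k * t)%R)%N].

Definition degX_at (j : 'I_s) : nat :=
  nat_min [set m | exists2 J, max_p_subscheme j J & is_mu_sub j J m].

Definition cayley_bacharach : Prop := forall j, degX_at j = regX.

(* [Ip j] is the primary component of I belonging to [p j]. *)
Definition primary_components (Ip : 'I_s -> idealr P) : Prop :=
  [/\ forall j, [/\ homog_ideal (Ip j), primary (Ip j)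
                  & forall f, f \in p j <-> exists k, f ^+ k \in Ip j]
    & forall f, f \in I <-> forall j, f \in Ip j].

Definition off_ideal (Ip : 'I_s -> idealr P) (j : 'I_s) : {pred P} :=
  [pred f | [forall k : 'I_s, (k != j) ==> (f \in Ip k)]].

(* The initial degree of the image of J in R. *)
Definition alpha (J : {pred P}) : nat :=
  nat_min [set i | exists f : P, [/\ f \is i.-homog, f \in J & \pi_R f != 0]].

Definition HF_condition (Ip : 'I_s -> idealr P) : Prop :=
  forall j i, let J := off_ideal Ip j in
    (HF J i : int) =
      if (i < alpha J)%N then (HF I i : int)
      else (HF I i : int) - (nu (p j) : int).

End Support.
End Scheme.
End ProjectiveScheme.

Notation Qh I := (loc (dens_h I)).

(* Main.v *)
Require Import Defs.
From HB Require Import structures.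
From mathcomp Require Import all_boot all_order all_algebra.
From mathcomp Require Import generic_quotient ring_quotient ring zify.
From mathcomp Require Import boolp classical_sets.
From mathcomp Require Import mpoly.

(* Write A for the product of the local rings and V_i for R_i / x_0^i in A, so
   that R = (+) V_i T^i and R~ = A[T]. In degree i the conductor is
   F_i = {a | a A <= V_i}, and, sigma being given by a nondegenerate form
   tr : A -> K, the complementary module in degree -i is the orthogonal of
   V_(i-1). Nondegeneracy gives F.C <= R~. As F_i is an ideal of A, equality
   holds as soon as, for each j, some i satisfies O_j <= V_i while some g
   orthogonal to V_(i-1) is a unit at p_j.
   (a) Take i = r_X, so that V_i = A; the Cayley-Bacharach property provides a
       socle element of O_j outside V_(i-1), and a form vanishing on V_(i-1) but
       not on this element is represented by such a g.
   (b) Take i = alpha; then V_(i-1) meets O_j in 0, and counting dimensions gives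
       O_j <= V_i. A form equal to tr on O_j and to 0 on V_(i-1) is represented
       by some g equal to 1 at p_j.
   That A is finite-dimensional and equal to V_i for i large follows from R
   being a finite K[x_0]-module: by Zorn's lemma, a variable that is not
   nilpotent modulo I + (X_0) would give a point on the hyperplane X_0 = 0. *)

Set Implicit Arguments.
Unset Strict Implicit.
Unset Printing Implicit Defensive.

Import GRing.Theory.

Local Open Scope classical_set_scope.
Local Open Scope ring_scope.
Local Open Scope quotient_scope.

(** * Homogeneous components of polynomials, and existence of homogeneous primes *)

Section HomogeneousComponents.
Variables (K : fieldType) (n : nat).
Local Notation P := {mpoly K[n.+1]}.
Implicit Types f g : P.
Local Notation comp := (pihomog (@mdeg n.+1)).

Lemma comp_homog d e f : f \is d.-homog -> comp e f = if e == d then f else 0.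
Proof.
move=> hf; case: eqP => [->|/eqP ne]; first exact: pihomog_dE.
by apply: pihomog_ne0 hf; rewrite eq_sym.
Qed.

Lemma comp_ge i f : (msize f <= i)%N -> comp i f = 0.
Proof.
move=> le_i; rewrite [f](pihomog_partitionE (leqnn (msize f))) raddf_sum big1 // => k _.
rewrite /= (comp_homog _ (pihomogP _ _ _)) gtn_eqF //.
exact: leq_trans (ltn_ord k) le_i.
Qed.

Lemma compM d e f g : f \is d.-homog -> comp (d + e) (f * g) = f * comp e g.
Proof.
move=> hf; pose N := msize g.
rewrite {1}[g](pihomog_partitionE (leqnn N)) mulr_sumr raddf_sum /=.
have hM k : f * comp k g \is (d + k).-homog by apply: dhomogM => //; apply: pihomogP.
case: (ltnP e N) => [ltN|leN].
  rewrite (bigD1 (Ordinal ltN)) //= (comp_homog _ (hM _)) eqxx big1 ?addr0 // => k ne.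
  rewrite (comp_homog _ (hM _)) eqn_add2l; case: eqP => // ek.
  by case/eqP: ne; apply: val_inj.
rewrite comp_ge // mulr0 big1 // => k _.
rewrite (comp_homog _ (hM _)) eqn_add2l gtn_eqF //.
exact: leq_trans leN.
Qed.

Lemma compM_lt d e f g : f \is d.-homog -> (e < d)%N -> comp e (f * g) = 0.
Proof.
move=> hf lt; rewrite [g](pihomog_partitionE (leqnn (msize g))) mulr_sumr raddf_sum.
rewrite big1 // => k _.
have hM : f * comp k g \is (d + k).-homog by apply: dhomogM => //; apply: pihomogP.
by rewrite /= (comp_homog _ hM) ltn_eqF // (leq_trans lt) ?leq_addr.
Qed.

Definition homog_set (J : set P) := forall d f, J f -> J (comp d f).
Definition ideal_set (J : set P) := forall a u v, J u -> J v -> J (a * u + v).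

Lemma ideal_set_sum (J : set P) (T : Type) (r : seq T) (Q : pred T) (F : T -> P) :
  J 0 -> ideal_set J -> (forall i, Q i -> J (F i)) -> J (\sum_(i <- r | Q i) F i).
Proof.
move=> J0 hJ hF; apply: big_ind => // x y Jx Jy.
by rewrite -[x]mul1r; apply: hJ.
Qed.

(* A homogeneous ideal that is prime on homogeneous elements is prime: compare
   the components of highest degree outside the ideal. *)
Lemma homog_prime_ext (J : set P) : J 0 -> ideal_set J -> homog_set J ->
  (forall d e f g, f \is d.-homog -> g \is e.-homog -> J (f * g) -> J f \/ J g) ->
  forall f g, J (f * g) -> J f \/ J g.
Proof.
move=> J0 idJ hJ prJ f g Jfg; apply: contrapT => /not_orP[nf ng].
have top h : ~ J h -> exists d, ~ J (comp d h) /\ forall k, (d < k)%N -> J (comp k h).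
  move=> nh; have [i ni] : exists i, `[< ~ J (comp i h) >].
    apply: contrapT => /forallNP hh; apply: nh.
    rewrite [h](pihomog_partitionE (leqnn (msize h))).
    by apply: ideal_set_sum => // i _; apply: contrapT => /asboolP; apply: hh.
  have bd i' : `[< ~ J (comp i' h) >] -> (i' <= msize h)%N.
    move/asboolP=> hi'; rewrite leqNgt; apply/negP => lt.
    by apply: hi'; rewrite comp_ge // ltnW.
  case: (ex_maxnP (ex_intro _ i ni) bd) => d /asboolP nd mx.
  exists d; split => // k ltk; apply: contrapT => /asboolP /mx.
  by rewrite leqNgt ltk.
have [d [nd hd]] := top f nf; have [e [ne he]] := top g ng.
have : J (comp d f * comp e g).
  have J1 u v : J u -> J v -> J (u + v).
    by move=> Ju Jv; rewrite -[u]mul1r; apply: idJ.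
  have JM u v : J u -> J (v * u) by move=> Ju; rewrite -[_ * _]addr0; apply: idJ.
  (* In degree [d + e], every other product of components has a factor of degree above [d] from [f]
     or above [e] from [g], and so lies in [J]. *)
  have -> : comp d f * comp e g = comp (d + e) (f * g) -
      comp (d + e) ((f - comp d f) * g + comp d f * (g - comp e g)).
    rewrite -raddfB /= -(compM e g (pihomogP _ _ _)).
    have -> : f * g - ((f - comp d f) * g + comp d f * (g - comp e g)) =
      comp d f * comp e g by ring.
    rewrite (compM _ _ (pihomogP _ _ _)) (compM _ _ (pihomogP _ _ _)).
    by rewrite pihomog_id.
  rewrite addrC; rewrite -mulN1r; apply: (idJ); last exact: hJ.
  rewrite raddfD /=; apply: (J1).
    rewrite {1}[g](pihomog_partitionE (leqnn (msize g))) mulr_sumr raddf_sum.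
    apply: ideal_set_sum => // k _ /=; rewrite mulrC.
    case: (leqP k (d + e)) => [lek|ltk]; last first.
      by rewrite (compM_lt _ (pihomogP _ _ _) ltk).
    rewrite -(subnKC lek) (compM _ _ (pihomogP _ _ _)).
    case: (leqP k e) => [leke|ltke]; last by rewrite mulrC; apply: (JM); apply: he.
    apply: (JM); rewrite raddfB /=.
    rewrite (comp_homog _ (pihomogP mdeg d f)).
    case: eqP => [->|/eqP nn]; first by rewrite subrr.
    by rewrite subr0; apply: hd; lia.
  by rewrite (compM _ _ (pihomogP _ _ _)) raddfB /= pihomog_id subrr mulr0.
by case/(prJ _ _ _ _ (pihomogP _ _ _) (pihomogP _ _ _)).
Qed.

(** Krull's argument: a homogeneous ideal maximal among those containing [J] and no power of [h] is
    prime on homogeneous elements, hence prime. *)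
Lemma exists_homog_prime (J : set P) (h : P) : J 0 -> ideal_set J -> homog_set J ->
  (forall M, ~ J (h ^+ M)) ->
  exists Q : prime_idealr P, [/\ homog_ideal Q, forall f, J f -> f \in Q & h \notin Q].
Proof.
move=> J0 idJ hJ hpow.
pose good (A : set P) := [/\ ideal_set A, homog_set A,
  forall j u, J j -> A u -> A (j + u) & forall M, ~ A (h ^+ M)].
have [A [[idA hA JA powA] mxA]] : exists A, good A /\ forall B, A `<` B -> ~ good B.
  apply: Zorn_bigcup => F Fg totF; split.
  - move=> a u v [X FX Xu] [Y FY Yv].
    have [XY|YX] := totF _ _ FX FY.
      by exists Y => //; have [+ _ _ _] := Fg _ FY; apply => //; apply: XY.
    by exists X => //; have [+ _ _ _] := Fg _ FX; apply => //; apply: YX.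
  - by move=> d f [X FX Xf]; exists X => //; have [_ + _ _] := Fg _ FX; apply.
  - by move=> j u Jj [X FX Xu]; exists X => //; have [_ _ + _] := Fg _ FX; apply.
  - by move=> M [X FX]; have [_ _ _] := Fg _ FX; apply.
(* Without 0 the maximal [A] would be empty, but then [J] is good and strictly larger. *)
have A0 : A 0.
  apply: contrapT => nA0.
  have Ae u : ~ A u.
    by move=> Au; apply: nA0; rewrite -(addNr u) -mulN1r; apply: idA.
  apply: (mxA J).
    split=> [u /Ae //|] /(_ 0 J0) /Ae //.
  split => // j u Jj Ju; rewrite -[j]mul1r; exact: idJ.
have JsubA f : J f -> A f by move=> Jf; rewrite -[f]addr0; apply: JA.
have AD u v : A u -> A v -> A (u + v).
  by move=> Au Av; rewrite -[u]mul1r; apply: idA.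
have AM u v : A u -> A (v * u) by move=> Au; rewrite -[_ * _]addr0; apply: idA.
(* Otherwise A + (f) would be good and strictly larger; [f] is taken homogeneous so that A + (f)
   is. *)
have ext d f : f \is d.-homog -> ~ A f -> exists M a u, A u /\ h ^+ M = u + a * f.
  move=> hf nAf; apply: contrapT => nex.
  apply: (mxA [set g | exists a u, A u /\ g = u + a * f]).
    split=> [u Au|sub]; first by exists 0, u; rewrite mul0r addr0.
    by apply: nAf; apply: sub; exists 1, 0; rewrite mul1r add0r.
  split.
  - move=> a _ _ [b [u [Au ->]]] [c [v [Av ->]]].
    exists (a * b + c), (a * u + v); split; first exact: idA.
    by ring.
  - move=> e _ [b [u [Au ->]]]; rewrite raddfD /=.
    case: (leqP d e) => [le|lt].
      exists (comp (e - d) b), (comp e u); split; first exact: hA.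
      by rewrite mulrC -{2}(subnKC le) compM // mulrC.
    exists 0, (comp e u); split; first exact: hA.
    by rewrite mulrC (compM_lt _ hf lt) mul0r.
  - move=> j _ Jj [b [u [Au ->]]]; exists b, (j + u); rewrite addrA.
    by split => //; apply: JA.
  - by move=> M [a [u [Au e]]]; apply: nex; exists M, a, u.
have prA f g : A (f * g) -> A f \/ A g.
  apply: homog_prime_ext => // {f g} d e f g hf hg Afg.
  apply: contrapT => /not_orP[nf ng].
  have [M [a [u [Au eu]]]] := ext _ _ hf nf.
  have [N [b [v [Av ev]]]] := ext _ _ hg ng.
  (* The product of the two powers of [h] lies in A + (f g), which is [A]. *)
  apply: (powA (M + N)%N); rewrite exprD eu ev.
  have -> : (u + a * f) * (v + b * g) = (v + b * g) * u + (a * f) * v + (a * b) * (f * g).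
    by ring.
  by apply: (AD); [apply: (AD)|]; apply: AM.
pose S : {pred P} := fun f => `[< A f >].
have Sid : idealr_closed S.
  split; [exact/asboolP| |].
    by apply/asboolP => A1; apply: (powA 0); rewrite expr0.
  by move=> a u v /asboolP Au /asboolP Av; apply/asboolP; apply: idA.
have Spr : prime_idealr_closed S.
  by move=> u v /asboolP /prA [] ?; apply/orP; [left|right]; apply/asboolP.
pose S1 := isIdealr.Build P S Sid.
pose S2 := isPrimeIdealrClosed.Build P S Spr.
pose Q : prime_idealr P := HB.pack S S1 S2.
exists Q; split.
- by move=> d f /asboolP Af; apply/asboolP; apply: hA.
- by move=> f Jf; apply/asboolP; apply: JsubA.
- by apply/asboolP => Ah; apply: (powA 1); rewrite expr1.
Qed.

End HomogeneousComponents.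

(** * Arithmetic of fractions in a localization *)

Section LocalizationTheory.
Variables (A : comNzRingType) (S : denominators A).

Lemma lfrac_eq a b c d : b \in S -> d \in S -> a * d = c * b ->
  lfrac S a b = lfrac S c d.
Proof.
move=> bS dS e; apply/eqP/(lfrac_eqP a c bS dS).
by exists 1; [exact: dens1 | rewrite e subrr mulr0].
Qed.

Lemma loc_frac (q : loc S) : exists a b, b \in S /\ q = lfrac S a b.
Proof.
rewrite -[q]reprK; case: (repr q) => -[a b] bS; exists a, b.
by split; rewrite ?(lfracE _ bS).
Qed.

Lemma lfrac0 b : b \in S -> lfrac S 0 b = 0.
Proof.
move=> bS; rewrite -(subrr (lfrac S 0 b)) lfracB // mul0r subrr.
by apply: lfrac_eq; rewrite ?densM // !mul0r.
Qed.

Lemma lfrac_eq0P a b : b \in S -> lfrac S a b = 0 <-> exists2 u, u \in S & u * a = 0.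
Proof.
move=> bS; rewrite -(lfrac0 bS); split=> [/eqP/(lfrac_eqP a 0 bS bS)[u uS e]|[u uS e]].
  exists (u * b); first exact: densM.
  by rewrite mul0r subr0 in e; rewrite -mulrA [b * a]mulrC.
apply/eqP/(lfrac_eqP a 0 bS bS); exists u => //.
by rewrite mul0r subr0 mulrA e mul0r.
Qed.

Lemma lfracN a b : b \in S -> - lfrac S a b = lfrac S (- a) b.
Proof.
move=> bS; rewrite -sub0r -(lfrac0 bS) lfracB //; apply: lfrac_eq => //.
  exact: densM.
by ring.
Qed.

Lemma lfracDl a c b : b \in S -> lfrac S a b + lfrac S c b = lfrac S (a + c) b.
Proof.
move=> bS; rewrite -[lfrac S c b]opprK lfracN // lfracB //; apply: lfrac_eq => //.
  exact: densM.
by ring.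
Qed.

End LocalizationTheory.

(** * The grading of R *)

Section GradedQuotient.
Variables (K : fieldType) (n : nat) (I : idealr {mpoly K[n.+1]}).
Local Notation P := {mpoly K[n.+1]}.
Local Notation R := {ideal_quot I}.
Local Notation comp := (pihomog (@mdeg n.+1)).
Local Notation x0 := (x0 I).
Local Notation hcomp := (@hcomp K n I).
Hypothesis hI : homog_ideal I.

(** Homogeneity of [I] makes the component independent of the representative chosen by [repr]. *)
Lemma hcomp_pi i (f : P) : hcomp i (\pi_R f) = \pi_R (comp i f).
Proof.
apply/eqP; rewrite -subr_eq0 -rmorphB pi_eq0 -raddfB /=.
by apply: hI; rewrite -pi_eq0 rmorphB /= reprK subrr.
Qed.

Lemma hcompD i r r' : hcomp i (r + r') = hcomp i r + hcomp i r'.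
Proof.
rewrite -[r]reprK -[r']reprK -(rmorphD \pi_R).
by rewrite !hcomp_pi raddfD rmorphD.
Qed.

Lemma Rhom_hcomp i r : Rhom i (hcomp i r).
Proof. by exists (comp i (repr r)) => //; apply: pihomogP. Qed.

Lemma hcomp_Rhom d e r : Rhom d r -> hcomp e r = if e == d then r else 0.
Proof.
move=> [f hf ->]; rewrite hcomp_pi (comp_homog _ hf).
by case: eqP => // _; rewrite rmorph0.
Qed.

Lemma hcompM d e t r : Rhom d t -> hcomp (d + e) (t * r) = t * hcomp e r.
Proof.
move=> [f hf ->]; rewrite -[r]reprK -rmorphM !hcomp_pi (compM _ _ hf).
by rewrite rmorphM.
Qed.

Lemma hcompM_lt d e t r : Rhom d t -> (e < d)%N -> hcomp e (t * r) = 0.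
Proof.
move=> [f hf ->] lt; rewrite -[r]reprK -rmorphM !hcomp_pi (compM_lt _ hf lt).
by rewrite rmorph0.
Qed.

Lemma hcomp_ge i r : (msize (repr r) <= i)%N -> hcomp i r = 0.
Proof. by move=> le; rewrite /Defs.hcomp comp_ge // rmorph0. Qed.

Lemma Rhom_sum r : r = \sum_(i < msize (repr r)) hcomp i r.
Proof.
rewrite -{1}[r]reprK {1}[repr r](pihomog_partitionE (mf := mdeg) (leqnn _)).
by rewrite rmorph_sum.
Qed.

Lemma hcomp_eq0 r : (forall i, hcomp i r = 0) -> r = 0.
Proof. by move=> h; rewrite (Rhom_sum r) big1. Qed.

Lemma Rhom0 i : Rhom i (0 : R).
Proof. by exists 0; [exact: rpred0 | rewrite rmorph0]. Qed.

Lemma RhomD i (a b : R) : Rhom i a -> Rhom i b -> Rhom i (a + b).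
Proof.
by move=> [f hf ->] [g hg ->]; exists (f + g); [rewrite rpredD|rewrite rmorphD].
Qed.

Lemma Rhom_bigsum i (T : Type) (s : seq T) (Q : pred T) (F : T -> R) :
  (forall k, Q k -> Rhom i (F k)) -> Rhom i (\sum_(k <- s | Q k) F k).
Proof. by move=> h; apply: big_ind => //; [exact: Rhom0 | exact: RhomD]. Qed.

Lemma Rhom_x0 : Rhom 1 x0.
Proof. by exists 'X_ord0 => //; rewrite dhomogX; apply/eqP/mdeg1. Qed.

Lemma RhomX d k (t : R) : Rhom d t -> Rhom (d * k) (t ^+ k).
Proof.
by move=> [f hf ->]; exists (f ^+ k); [exact: dhomogMn | rewrite rmorphXn].
Qed.

Lemma Rhom_x0X k : Rhom k (x0 ^+ k).
Proof. by rewrite -{1}[k]mul1n; apply: RhomX Rhom_x0. Qed.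

Lemma Rhom_const c : Rhom 0 (constR I c).
Proof.
exists c%:MP => //.
by rewrite -[_%:MP]mulr1 mul_mpolyC rpredZ // dhomog1.
Qed.

Lemma constRD a b : constR I (a + b) = constR I a + constR I b.
Proof. by rewrite /constR mpolyCD rmorphD. Qed.
Lemma constRM a b : constR I (a * b) = constR I a * constR I b.
Proof. by rewrite /constR mpolyCM rmorphM. Qed.
Lemma constR0 : constR I 0 = 0.
Proof. by rewrite /constR mpolyC0 rmorph0. Qed.
Lemma constR1 : constR I 1 = 1.
Proof. by rewrite /constR rmorph1. Qed.

Lemma constRN c : constR I (- c) = - constR I c.
Proof. by apply/eqP; rewrite -addr_eq0 -constRD addNr constR0. Qed.

Lemma constR_eq0 c : constR I c = 0 -> c = 0.
Proof.
move=> e; apply: contraTeq (oner_neq0 R) => c0.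
by rewrite -constR1 -(mulVf c0) constRM e mulr0 eqxx.
Qed.

End GradedQuotient.

(** * Germs at a point off the hyperplane X_0 = 0 *)

Section Germs.
Variables (K : fieldType) (n : nat) (I : idealr {mpoly K[n.+1]}).
Local Notation P := {mpoly K[n.+1]}.
Local Notation R := {ideal_quot I}.
Local Notation x0 := (x0 I).
Variable x : projPoint I.
Hypothesis X0x : 'X_ord0 \notin x.
Local Notation germ := (@germ K n I x).

Lemma x0_dens k : x0 ^+ k \in dens_at x.
Proof.
elim: k => [|k IH]; first by rewrite expr0 dens1.
rewrite exprS densM //; apply/asboolP; exists 1%N, 'X_ord0; split => //.
by rewrite dhomogX; apply/eqP/mdeg1.
Qed.

(** X_0 does not vanish at [x], so this fraction has degree 0 and the default value in [germ] does
    not occur. *)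
Lemma val_germ i r : Rhom i r -> val (germ i r) = lfrac (dens_at x) r (x0 ^+ i).
Proof.
move=> hr; rewrite /germ insubdK //; apply/asboolP; exists i, r, (x0 ^+ i).
by split => //; [exact: Rhom_x0X | exact: x0_dens].
Qed.

Lemma germ0 i : germ i 0 = 0.
Proof. by apply: val_inj; rewrite val_germ ?lfrac0 ?x0_dens //; exact: Rhom0. Qed.

Lemma germD i r r' : Rhom i r -> Rhom i r' -> germ i (r + r') = germ i r + germ i r'.
Proof.
move=> hr hr'; apply: val_inj.
by rewrite rmorphD /= !val_germ ?lfracDl ?x0_dens //; exact: RhomD.
Qed.

Lemma germM i j r r' : Rhom i r -> Rhom j r' ->
  germ (i + j) (r * r') = germ i r * germ j r'.
Proof.
move=> hr hr'; apply: val_inj.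
rewrite rmorphM /= !val_germ ?lfracM ?x0_dens ?exprD //; exact: RhomM.
Qed.

Lemma germ_x0X k : germ k (x0 ^+ k) = 1.
Proof.
apply: val_inj; rewrite val_germ ?rmorph1; last exact: Rhom_x0X.
by rewrite -lfrac11; apply: lfrac_eq; rewrite ?dens1 ?x0_dens ?mulr1 ?mul1r.
Qed.

Lemma germ1 : germ 0 1 = 1.
Proof. by rewrite -(expr0 x0) germ_x0X. Qed.

Lemma germ_eq0 i r : Rhom i r -> germ i r = 0 <->
  exists2 u, u \in dens_at x & u * r = 0.
Proof.
move=> hr; rewrite -(lfrac_eq0P _ (x0_dens i)) -(val_germ hr); split=> [->|e].
  exact: (raddf0 val).
by apply: val_inj; apply: (etrans e); apply/esym; apply: (raddf0 val).
Qed.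

End Germs.

(** * Standing hypotheses, and the action of x_0 on R *)

Record off_hyperplane (K : fieldType) (n : nat) (I : idealr {mpoly K[n.+1]})
    (s : nat) (p : 'I_s -> projPoint I) (Ip : 'I_s -> idealr {mpoly K[n.+1]}) :
    Prop := OffHyperplane {
  homogI : homog_ideal I;
  dim0 : zero_dimensional I;
  supp : enumerates_support p;
  X0notin : forall j, 'X_ord0 \notin p j;
  prim : primary_components p Ip }.

Section Regularity.
Variables (K : fieldType) (n : nat) (I : idealr {mpoly K[n.+1]}).
Variables (s : nat) (p : 'I_s -> projPoint I) (Ip : 'I_s -> idealr {mpoly K[n.+1]}).
Local Notation P := {mpoly K[n.+1]}.
Local Notation R := {ideal_quot I}.
Local Notation comp := (pihomog (@mdeg n.+1)).
Local Notation x0 := (x0 I).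
Local Notation hcomp := (@hcomp K n I).
Hypothesis H : off_hyperplane p Ip.

(** The ideal [I] + (X_0) of the intersection with the hyperplane X_0 = 0, which is empty. *)
Let J : set P := [set f | exists a g, a \in I /\ f = a + 'X_ord0 * g].

Let J0 : J 0.
Proof. by exists 0, 0; rewrite mulr0 addr0 rpred0. Qed.

Let idJ : ideal_set J.
Proof.
move=> a _ _ [b [f [bI ->]]] [c [g [cI ->]]].
exists (a * b + c), (a * f + g); split; last by ring.
by rewrite rpredD // idealMr.
Qed.

Lemma X0homog : ('X_ord0 : P) \is 1.-homog.
Proof. by rewrite dhomogX; apply/eqP/mdeg1. Qed.

Let homJ : homog_set J.
Proof.
move=> d _ [a [g [aI ->]]]; rewrite raddfD /=; case: d => [|d].
  exists (comp 0 a), 0; rewrite mulr0 (compM_lt _ X0homog) //.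
  by split => //; apply: (homogI H).
exists (comp d.+1 a), (comp d g); split; first exact: (homogI H).
by rewrite (compM d g X0homog : comp d.+1 _ = _).
Qed.

(* Every relevant homogeneous prime over [I] is some [p j], which misses X_0. *)
Let power_in_J (i : 'I_n.+1) : exists M, J ('X_i ^+ M).
Proof.
apply: contrapT => /forallNP nJ.
have [Q [hQ JQ XQ]] := exists_homog_prime J0 idJ homJ nJ.
have IQ f : f \in I -> f \in Q.
  by move=> fI; apply: JQ; exists f, 0; rewrite mulr0 addr0.
pose x := ProjPoint hQ IQ (ex_intro _ i XQ).
have [_ cl] := dim0 H; have [_ _ /(_ x (cl x))[j xj]] := supp H.
have := X0notin H j; rewrite -xj => /negP; apply.
by apply: JQ; exists 0, 1; rewrite mulr1 add0r rpred0.
Qed.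

(** A monomial of degree above the sum of the [M i] is divisible by some X_i^(M i), hence lies in
    [J]. Taking components of degree [d.+1] then turns a form of that degree into a multiple of X_0
    modulo [I]. *)
Lemma x0_surj : exists D, forall d r, (D <= d)%N -> Rhom d.+1 r ->
  exists2 r', Rhom d r' & r = x0 * r'.
Proof.
have [M hM] := choice power_in_J.
exists (\sum_i M i)%N => d _ leD [f hf ->].
have [a [g [aI ef]]] : J f.
  rewrite [f]mpolyE big_seq; apply: ideal_set_sum => // m mf.
  have dm := dhomog_mf hf mf.
  have [i lei] : exists i, (M i <= m i)%N.
    apply: contrapT => /forallNP ne.
    have : (mdeg m <= \sum_i M i)%N.
      rewrite mdegE; apply: leq_sum => i _.
      by have /negP := ne i; rewrite -ltnNge => /ltnW.
    by rewrite dm leqNgt ltnS leD.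
  have -> : f@_m *: 'X_[m] = (f@_m *: 'X_[m - U_(i) *+ M i]) * 'X_i ^+ M i :> P.
    rewrite mpolyXn -scalerAl -mpolyXD submK //; apply/mnm_lepP => k.
    rewrite mulmnE mnm1E; case: eqP => [<-|_]; first by rewrite mul1n.
    by rewrite mul0n.
  by rewrite -[_ * _]addr0; apply: idJ.
exists (\pi_R (comp d g)); first by exists (comp d g) => //; apply: pihomogP.
rewrite -rmorphM; apply/eqP; rewrite -subr_eq0 -rmorphB pi_eq0.
rewrite -(pihomog_dE hf) {1}ef raddfD /= (compM d g X0homog : comp d.+1 _ = _).
by rewrite addrK; apply: (homogI H).
Qed.

(** X_0 is outside each [p j], the radical of the primary ideal [Ip j], so it cancels modulo every
    [Ip j]. *)
Lemma x0_nzd r : x0 * r = 0 -> r = 0.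
Proof.
rewrite -[r]reprK -rmorphM => /eqP; rewrite pi_eq0 => e; apply/eqP; rewrite pi_eq0.
have [hIp hI] := prim H; apply/hI => j; have [_ pr rad] := hIp j.
have /hI/(_ j) := e; rewrite mulrC => /pr[//|/rad].
by rewrite (negPf (X0notin H j)).
Qed.

Lemma x0X_nzd k r : x0 ^+ k * r = 0 -> r = 0.
Proof.
by elim: k => [|k IH]; rewrite ?mul1r // exprS -mulrA => /x0_nzd /IH.
Qed.

Lemma x0X_hnzd k : x0 ^+ k \in dens_h I.
Proof.
apply/asboolP; split=> [|r]; last exact: x0X_nzd.
by exists k; apply: Rhom_x0X.
Qed.

Lemma x0X_surj : exists D, forall d r, Rhom (D + d) r ->
  exists2 r', Rhom D r' & r = x0 ^+ d * r'.
Proof.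
have [D hD] := x0_surj; exists D; elim=> [|d IH] r.
  by rewrite addn0 => hr; exists r; rewrite // mul1r.
rewrite addnS => /(hD _ _ (leq_addr _ _))[r' /IH[t ht ->] ->].
by exists t => //; rewrite exprS mulrA.
Qed.

Lemma mpoly_of_sum d (T : Type) (r : seq T) (F : T -> dhomog n.+1 K d) :
  (\sum_(i <- r) F i : dhomog n.+1 K d) = \sum_(i <- r) (F i : P) :> P.
Proof. exact: (raddf_sum (@mpoly_of_dhomog n.+1 K d)). Qed.

(* Since the dimension of R_i is bounded, multiplication by t has a stable
   image, up to powers of x_0. *)
Lemma fitting d t : Rhom d t -> exists m e c,
  Rhom e c /\ t ^+ m * x0 ^+ (d + e) = t ^+ m.+1 * c.
Proof.
have [D hD] := x0X_surj => ht.
pose V : vectType K := dhomog n.+1 K D.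
pose N := \dim {:V}.
(* The powers of x_0 bring all [v i] to the degree D + d N. Each is then x_0^(d N) times the class
   of a form of degree D, and N + 1 such forms are linearly dependent. *)
pose v (i : 'I_N.+1) := t ^+ i * x0 ^+ (D + d * (N - i)).
have hv i : exists w : V, v i = x0 ^+ (d * N) * \pi_R (w : P).
  have : Rhom (D + d * N) (v i).
    have -> : (D + d * N = d * i + (D + d * (N - i)))%N.
      by rewrite addnCA -mulnDr subnKC // -ltnS.
    by apply: RhomM (RhomX _ ht) (Rhom_x0X _ _).
  by case/hD => _ [f hf ->] ->; exists (DHomog hf).
have [w hw] := choice hv.
have : ~~ free [tuple w i | i < N.+1].
  apply/negP => fr; have := dimvS (subvf <<[tuple w i | i < N.+1]>>%VS).
  by rewrite -/N; move/eqP: fr => ->; rewrite size_tuple ltnn.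
move/freeP => /existsNP[a /not_implyP[ea /existsNP[i0 /eqP a0]]].
have {}ea : \sum_i constR I (a i) * v i = 0.
  transitivity (x0 ^+ (d * N) * \pi_R (\sum_i a i *: (w i : P))).
    rewrite rmorph_sum mulr_sumr; apply: eq_bigr => i _.
    by rewrite hw mulrCA -mul_mpolyC rmorphM.
  suff -> : \sum_i a i *: (w i : P) = 0 by rewrite rmorph0 mulr0.
  rewrite -[RHS](congr1 (@mpoly_of_dhomog _ _ _) ea) mpoly_of_sum.
  by apply: eq_bigr => i _; rewrite -tnth_nth tnth_mktuple.
(* The lowest term of the relation is solved for; all the others contain t^(m+1). *)
have [m am mn] := arg_minnP (P := fun i => a i != 0) val a0.
have {}mn (i : 'I_N.+1) : (i < m)%N -> a i = 0.
  by move=> lt; apply: contraTeq lt => /mn; rewrite -leqNgt.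
have em : v m = \sum_(i < N.+1 | (m < i)%N) constR I (- (a i / a m)) * v i.
  have -> : v m = constR I (a m)^-1 * (constR I (a m) * v m).
    by rewrite mulrA -constRM mulVf // constR1 mul1r.
  move: ea; rewrite (bigD1 m) //= => /eqP; rewrite addr_eq0 => /eqP ->.
  rewrite -sumrN mulr_sumr [LHS]big_mkcond [RHS]big_mkcond /=; apply: eq_bigr => i _.
  case: (ltngtP m i) => [lt|lt|e].
  - by rewrite -val_eqE /= gtn_eqF // mulrN mulrA -constRM [(a m)^-1 * _]mulrC constRN mulNr.
  - by rewrite (mn _ lt) constR0 mul0r oppr0 mulr0 if_same.
  - by rewrite -val_eqE /= e eqxx.
(* For m = N no higher term is left: [v m] is 0 and c = 0 serves. *)
exists m; case: (ltnP m N) => [ltm|lem]; last first.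
  exists (D + d * (N - m))%N, 0; split; first exact: Rhom0.
  rewrite mulr0 addnC exprD mulrA -/(v m) em big1 ?mul0r // => i ltmi.
  by have := ltn_ord i; rewrite ltnS leqNgt (leq_ltn_trans lem ltmi).
exists (D + d * (N - m.+1))%N,
  (\sum_(i < N.+1 | (m < i)%N) constR I (- (a i / a m)) *
     (t ^+ (i - m.+1) * x0 ^+ (D + d * (N - i)))); split.
  apply: Rhom_bigsum => i lti; rewrite -[(D + _)%N]add0n; apply: RhomM (Rhom_const _ _) _.
  have -> : (D + d * (N - m.+1) = d * (i - m.+1) + (D + d * (N - i)))%N.
    rewrite addnCA -mulnDr; congr (_ + _ * _)%N.
    by have := ltn_ord i; lia.
  exact: RhomM (RhomX _ ht) (Rhom_x0X _ _).
have -> : (d + (D + d * (N - m.+1)) = D + d * (N - m))%N by nia.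
rewrite -/(v m) em mulr_sumr; apply: eq_bigr => i lti.
by rewrite [RHS]mulrCA; congr (_ * _); rewrite mulrA -exprD subnKC.
Qed.

End Regularity.

(** * Units and fractions in a local ring *)

Section LocalUnits.
Variables (K : fieldType) (n : nat) (I : idealr {mpoly K[n.+1]}).
Local Notation R := {ideal_quot I}.
Local Notation x0 := (x0 I).
Variable x : projPoint I.
Hypothesis X0x : 'X_ord0 \notin x.

Lemma germ_inv d t : Rhom d t -> t \in dens_at x -> exists b, germ x d t * b = 1.
Proof.
move=> ht tS; have ht0 : lfrac (dens_at x) (x0 ^+ d) t \in @deg0_pred K n I x.
  by apply/asboolP; exists d, (x0 ^+ d), t; split => //; apply: Rhom_x0X.
exists (LocalRing ht0); apply: val_inj.
rewrite rmorphM rmorph1 /= val_germ // lfracM ?x0_dens // -lfrac11.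
by apply: lfrac_eq; rewrite ?densM ?dens1 ?x0_dens // mulr1 mul1r mulrC.
Qed.

Lemma localRing_frac (a : localRing x) : exists d r u,
  [/\ Rhom d r, Rhom d u, u \in dens_at x & a * germ x d u = germ x d r].
Proof.
case: a => a ha; move/asboolP: (ha) => [d [r [u [hr hu uS ea]]]].
exists d, r, u; split => //; apply: val_inj.
rewrite rmorphM /= !val_germ // ea lfracM ?x0_dens //.
by apply: lfrac_eq; rewrite ?densM ?x0_dens // mulrA.
Qed.

End LocalUnits.

(** * The product A of the local rings and its idempotents *)

Section GermRing.
Variables (K : fieldType) (n : nat) (I : idealr {mpoly K[n.+1]}).
Variables (s : nat) (p : 'I_s -> projPoint I).

Definition germs : Type := forall j, localRing (p j).
HB.instance Definition _ := gen_eqMixin germs.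
HB.instance Definition _ := gen_choiceMixin germs.

Definition germs_add (a b : germs) : germs := fun j => a j + b j.
Definition germs_opp (a : germs) : germs := fun j => - a j.
Definition germs_mul (a b : germs) : germs := fun j => a j * b j.

Local Tactic Notation "pointwise" constr(t) :=
  by move=> *; apply: functional_extensionality_dep => j; apply: t.

Lemma germs_addA : associative germs_add. Proof. pointwise addrA. Qed.
Lemma germs_addC : commutative germs_add. Proof. pointwise addrC. Qed.
Lemma germs_add0 : left_id (fun=> 0) germs_add. Proof. pointwise add0r. Qed.
Lemma germs_addN : left_inverse (fun=> 0) germs_opp germs_add.
Proof. pointwise addNr. Qed.
HB.instance Definition _ := GRing.isZmodule.Build germs
  germs_addA germs_addC germs_add0 germs_addN.

Lemma germs_mulA : associative germs_mul. Proof. pointwise mulrA. Qed.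
Lemma germs_mulC : commutative germs_mul. Proof. pointwise mulrC. Qed.
Lemma germs_mul1 : left_id (fun=> 1) germs_mul. Proof. pointwise mul1r. Qed.
Lemma germs_mulD : left_distributive germs_mul +%R. Proof. pointwise mulrDl. Qed.
HB.instance Definition _ := GRing.Zmodule_isComPzRing.Build germs
  germs_mulA germs_mulC germs_mul1 germs_mulD.

Lemma germsD (a b : germs) j : (a + b) j = a j + b j. Proof. by []. Qed.
Lemma germsN (a : germs) j : (- a) j = - a j. Proof. by []. Qed.
Lemma germsM (a b : germs) j : (a * b) j = a j * b j. Proof. by []. Qed.
Lemma germs0 j : (0 : germs) j = 0. Proof. by []. Qed.
Lemma germs1 j : (1 : germs) j = 1. Proof. by []. Qed.
Lemma germs_sum (T : Type) (r : seq T) (Q : pred T) (F : T -> germs) j :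
  (\sum_(i <- r | Q i) F i) j = \sum_(i <- r | Q i) F i j.
Proof. by elim/big_rec2 : _ => // i x y _ <-. Qed.

Lemma germsP (a b : germs) : (forall j, a j = b j) -> a = b.
Proof. exact: functional_extensionality_dep. Qed.

Definition idem (j : 'I_s) : germs := fun k => (k == j)%:R.

Lemma idem_sum : \sum_j idem j = 1.
Proof.
apply: germsP => k; rewrite germs_sum (bigD1 k) //= /idem eqxx big1 ?addr0 // => j ne.
by rewrite eq_sym (negPf ne).
Qed.

Definition inj_at (j : 'I_s) (a : localRing (p j)) : germs :=
  dfwith (fun k => 0 : localRing (p k)) a.

Lemma inj_atE (j : 'I_s) (a : localRing (p j)) : inj_at a j = a.
Proof. by rewrite /inj_at dfwith_in. Qed.

Lemma inj_at_out (j k : 'I_s) (a : localRing (p j)) : k != j -> inj_at a k = 0.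
Proof. by move=> ne; rewrite /inj_at dfwith_out // eq_sym. Qed.

Lemma idemM (j : 'I_s) (a : germs) : idem j * a = inj_at (a j).
Proof.
apply: germsP => k; rewrite germsM /idem; case: eqP => [->|/eqP ne].
  by rewrite inj_atE mul1r.
by rewrite inj_at_out // mul0r.
Qed.

Definition constA (c : K) : germs := fun j => constO (p j) c.

(** The coefficient of T^i in the image of [r] in A[T], taken at all points at once
    ([itilde_coef]). *)
Definition germ_coef (i : nat) (r : {ideal_quot I}) : germs := fun j => germ (p j) i (hcomp i r).

End GermRing.

(** * Separating the points; every element of A comes from forms of high degree *)

Section Separation.
Variables (K : fieldType) (n : nat) (I : idealr {mpoly K[n.+1]}).
Variables (s : nat) (p : 'I_s -> projPoint I) (Ip : 'I_s -> idealr {mpoly K[n.+1]}).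
Local Notation P := {mpoly K[n.+1]}.
Local Notation R := {ideal_quot I}.
Local Notation comp := (pihomog (@mdeg n.+1)).
Local Notation x0 := (x0 I).
Local Notation hcomp := (@hcomp K n I).
Local Notation A := (germs p).
Local Notation cf := (@germ_coef K n I s p).
Hypothesis H : off_hyperplane p Ip.

Lemma prime_pow (Q : prime_idealr P) f k : f \notin Q -> f ^+ k \notin Q.
Proof.
move=> nf; elim: k => [|k IH]; first by rewrite expr0 idealr1.
by rewrite exprS prime_idealrM negb_or nf.
Qed.

(** As [p k] is closed, it is not contained in [p j] for k != j. A component of some element of
    [p k] therefore avoids [p j], and a power of it lies in [Ip k]. These powers are multiplied
    together. *)
Lemma separator j : exists d f,
  [/\ f \is d.-homog, f \notin p j & forall k, k != j -> f \in Ip k].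
Proof.
have [hIp _] := prim H; have [cl inj _] := supp H.
have sep k : exists df : nat * P,
    [/\ df.2 \is df.1.-homog, df.2 \notin p j & k != j -> df.2 \in Ip k].
  case: (eqVneq k j) => [_|ne].
    by exists (0%N, 1); split => //=; [exact: dhomog1 | rewrite idealr1].
  have [_ _ rad] := hIp k.
  have [f fk [d fj]] : exists2 f, f \in p k & exists d, comp d f \notin p j.
    apply: contrapT => nex; case/eqP: ne; apply: inj.
    have sub : {subset p k <= p j}.
      move=> f fk; rewrite [f](pihomog_partitionE (mf := mdeg) (leqnn _)).
      apply: rpred_sum => i _; apply: contrapT => /negP fj.
      by apply: nex; exists f => //; exists i.
    by move=> f; apply/idP/idP; [apply: sub | apply: (cl k)].
  have /rad[m fm] : comp d f \in p k by apply: (@pt_homog _ _ _ (p k)).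
  exists ((d * m)%N, comp d f ^+ m); split => //=; last exact: prime_pow.
  by apply: dhomogMn; apply: pihomogP.
have [F hF] := choice sep.
exists (\sum_k (F k).1)%N, (\prod_k (F k).2); split.
- elim/big_rec2: _ => [|k d f _ hf].
  + exact: dhomog1.
  + by apply: dhomogM => //; have [] := hF k.
- apply: (big_ind (fun f : P => f \notin p j)) => [|f g nf ng|k _]; first by rewrite idealr1.
    by rewrite prime_idealrM negb_or nf.
  by have [] := hF k.
- move=> k ne; rewrite (bigD1 k) //= mulrC; apply: idealMr.
  by have [_ _] := hF k; apply.
Qed.

(** Denominators outside [p k] cancel modulo the primary ideal [Ip k]. Conversely, the separator of
    [k] multiplies an [f] in [Ip k] into every component, hence into [I]. *)
Lemma germ_eq0_prim k i f : f \is i.-homog ->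
  germ (p k) i (\pi_R f) = 0 <-> f \in Ip k.
Proof.
move=> hf; have hr : Rhom i (\pi_R f : R) by exists f.
have [hIp hI] := prim H; have [_ pr rad] := hIp k.
rewrite (germ_eq0 (X0notin H k) hr); split.
  move=> [_ /asboolP[d [u [hu uk ->]]]]; rewrite -rmorphM => /eqP.
  rewrite pi_eq0 => /hI/(_ k); rewrite mulrC => /pr[//|/rad].
  by rewrite (negPf uk).
move=> fk; have [d [u [hu uk uI]]] := separator k.
exists (\pi_R u); first by apply/asboolP; exists d, u.
rewrite -rmorphM; apply/eqP; rewrite pi_eq0; apply/hI => l.
case: (eqVneq l k) => [->|/uI ul]; first exact: idealMr.
by rewrite mulrC; apply: idealMr.
Qed.

Lemma cfD i r r' : cf i (r + r') = cf i r + cf i r'.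
Proof.
apply: germsP => j; rewrite germsD /germ_coef (hcompD (homogI H)).
by rewrite (germD (X0notin H j)) //; apply: Rhom_hcomp.
Qed.

Lemma cf0 i : cf i 0 = 0.
Proof. by apply: (addrI (cf i 0)); rewrite -cfD !addr0. Qed.

Lemma cfN i r : cf i (- r) = - cf i r.
Proof. by apply/eqP; rewrite -addr_eq0 -cfD addNr cf0. Qed.

Lemma cf_sum i (T : Type) (l : seq T) (Q : pred T) (F : T -> R) :
  cf i (\sum_(k <- l | Q k) F k) = \sum_(k <- l | Q k) cf i (F k).
Proof. by elim/big_rec2: _ => [|k a b _ <-]; rewrite ?cf0 ?cfD. Qed.

Lemma cf_hom d t i : Rhom d t -> 
  cf i t = if i == d then ((fun j => germ (p j) d t) : A) else (0 : A).
Proof.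
move=> ht; apply: germsP => j; rewrite /germ_coef (hcomp_Rhom (homogI H) _ ht).
by case: eqP => [->//|_]; rewrite (germ0 (X0notin H j)).
Qed.

Lemma cfM d t i r : Rhom d t -> cf (d + i) (t * r) = cf d t * cf i r.
Proof.
move=> ht; apply: germsP => j; rewrite germsM /germ_coef (hcompM (homogI H) _ _ ht).
rewrite (germM (X0notin H j) ht (Rhom_hcomp _ _)) (hcomp_Rhom (homogI H) _ ht).
by rewrite eqxx.
Qed.

Lemma cfM_lt d t i r : Rhom d t -> (i < d)%N -> cf i (t * r) = 0.
Proof.
move=> ht lt; apply: germsP => j; rewrite /germ_coef (hcompM_lt (homogI H) _ ht lt).
by rewrite (germ0 (X0notin H j)).
Qed.

Lemma cf_x0X k : cf k (x0 ^+ k) = 1.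
Proof.
rewrite (cf_hom _ (Rhom_x0X I k)) eqxx; apply: germsP => j.
exact: (germ_x0X (X0notin H j)).
Qed.

Lemma cf_x0XM k i r : cf (k + i) (x0 ^+ k * r) = cf i r.
Proof. by rewrite (cfM _ _ (Rhom_x0X I k)) cf_x0X mul1r. Qed.

Lemma cf_const c i r : cf i (constR I c * r) = constA p c * cf i r.
Proof.
rewrite -{1}[i]add0n (cfM _ _ (Rhom_const I c)); congr (_ * _).
by rewrite (cf_hom _ (Rhom_const I c)).
Qed.

Lemma cf_inj d t : Rhom d t -> cf d t = 0 -> t = 0.
Proof.
move=> ht; rewrite (cf_hom _ ht) eqxx; case: ht => f hf -> e.
apply/eqP; rewrite pi_eq0; have [_ hI] := prim H; apply/hI => k.
by rewrite -(germ_eq0_prim k hf) -[LHS]/((fun j => germ (p j) d (\pi_R f)) k) e.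
Qed.

Lemma cf_hcomp i r : cf i (hcomp i r) = cf i r.
Proof.
apply: germsP => j; rewrite /germ_coef (hcomp_Rhom (homogI H) _ (Rhom_hcomp i r)).
by rewrite eqxx.
Qed.

Lemma cf_eq0 r : (forall i, cf i r = 0) -> r = 0.
Proof.
move=> h; apply: hcomp_eq0 => i.
by apply: (cf_inj (Rhom_hcomp i r)); rewrite cf_hcomp.
Qed.

Lemma itilde_coef j r i : (itilde (p j) r)`_i = cf i r j.
Proof.
rewrite coef_poly /germ_coef; case: ltnP => // le.
by rewrite hcomp_ge // (germ0 (X0notin H j)).
Qed.

(** [fitting] gives b^m (x_0^(d+e) - b c) = 0, where b^m cancels. Powers of x_0 thus suffice as
    denominators in Q^h(R). *)
Lemma hnzd_dvd_x0 d b : b \in dens_h I -> Rhom d b -> exists e c,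
  Rhom e c /\ b * c = x0 ^+ (d + e).
Proof.
move=> /asboolP[_ nzb] hb; have [m [e [c [hc ec]]]] := fitting H hb.
exists e, c; split => //; apply/eqP; rewrite eq_sym -subr_eq0; apply/eqP.
have : b ^+ m * (x0 ^+ (d + e) - b * c) = 0 by rewrite mulrBr ec exprSr mulrA subrr.
by elim: m {ec} => [|m IH]; rewrite ?mul1r // exprS -mulrA => /nzb.
Qed.

(** The germ of [t] is a unit, so its m-th power cancels in the germ of the relation from [fitting].
    Hence elements of the local ring need only powers of x_0 as denominators. *)
Lemma germ_inv_hom j d t : Rhom d t -> t \in dens_at (p j) -> exists e c,
  Rhom e c /\ germ (p j) d t * germ (p j) e c = 1.
Proof.
move=> ht tS; have [m [e [c [hc ec]]]] := fitting H ht; exists e, c; split => //.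
have X0j := X0notin H j.
have [b eb] := germ_inv X0j ht tS.
have hM k : germ (p j) (d * k) (t ^+ k) = germ (p j) d t ^+ k.
  elim: k => [|k IH]; first by rewrite muln0 !expr0 (germ1 X0j).
  by rewrite mulnS !exprS (germM X0j ht (RhomX k ht)) IH.
have := congr1 (germ (p j) (d * m + (d + e))) ec.
rewrite (germM X0j (RhomX _ ht) (Rhom_x0X _ _)) (germ_x0X X0j) mulr1 hM.
rewrite addnA -mulnSr (germM X0j (RhomX _ ht) hc) hM => e1.
have := congr1 (fun y => b ^+ m * y) e1.
rewrite exprSr !mulrA -!exprMn [b * _]mulrC eb !expr1n !mul1r => <-.
by [].
Qed.

Lemma localRing_hom j (a : localRing (p j)) : exists d t,
  Rhom d t /\ germ (p j) d t = a.
Proof.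
have X0j := X0notin H j.
have [d [r [u [hr hu uS e]]]] := localRing_frac X0j a.
have [m [c [hc ec]]] := germ_inv_hom hu uS.
exists (d + m)%N, (r * c); split; first exact: RhomM.
by rewrite (germM X0j hr hc) -e -mulrA ec mulr1.
Qed.

Lemma cf_pad k d t : (d <= k)%N -> Rhom d t -> exists2 t', Rhom k t' & cf k t' = cf d t.
Proof.
move=> le ht; exists (x0 ^+ (k - d) * t); rewrite -{1}(subnK le).
  exact: RhomM (Rhom_x0X _ _) ht.
exact: cf_x0XM.
Qed.

(** A lift of [a] is multiplied by the separator of [j], which kills the other germs, and by a form
    inverting the separator at [p j]. *)
Lemma cf_at j (a : localRing (p j)) : exists d t, Rhom d t /\ cf d t = inj_at a.
Proof.
have X0j := X0notin H j.
have [d [f [hf fj fk]]] := separator j.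
have hr : Rhom d (\pi_R f : R) by exists f.
have fS : \pi_R f \in dens_at (p j) by apply/asboolP; exists d, f.
have [e [c [hc ec]]] := germ_inv_hom hr fS.
have [m [t [ht et]]] := localRing_hom a.
exists (d + (e + m))%N, (\pi_R f * (c * t)).
have h2 := RhomM hc ht.
split; first exact: RhomM.
rewrite (cf_hom _ (RhomM hr h2)) eqxx; apply: germsP => k.
case: (eqVneq k j) => [->|ne].
  by rewrite inj_atE (germM X0j hr h2) (germM X0j hc ht) mulrA ec mul1r.
have X0k := X0notin H k.
rewrite inj_at_out // (germM X0k hr h2).
by have /(germ_eq0_prim k hf) -> := fk k ne; rewrite mul0r.
Qed.

(** The lifts of the components of [a] are added in a common degree; [x0X_surj] then divides the sum
    down to degree D, which does not depend on [a]. *)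
Lemma cf_surj : exists D, forall i (a : A), (D <= i)%N -> exists2 t, Rhom i t & cf i t = a.
Proof.
have [D hD] := x0X_surj H; exists D.
suff hs (a : A) : exists2 t, Rhom D t & cf D t = a.
  by move=> i a le; have [t ht <-] := hs a; apply: cf_pad.
have [d hd] := choice (fun j => cf_at (a j)); have [t ht] := choice hd.
pose N := (D + \sum_j d j)%N.
have ha j : exists t', Rhom N t' /\ cf N t' = inj_at (a j).
  have [htj <-] := ht j.
  suff [t' ? ?] : exists2 t', Rhom N t' & cf N t' = cf (d j) (t j) by exists t'.
  apply: cf_pad => //.
  by rewrite /N (bigD1 j) //= addnCA leq_addr.
have [t' ht'] := choice ha.
have hsum : Rhom N (\sum_j t' j) by apply: Rhom_bigsum => j _; have [] := ht' j.
have [u hu eu] := hD _ _ hsum; exists u => //.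
rewrite -(cf_x0XM (\sum_j d j)%N) addnC -eu cf_sum -[RHS]mul1r -idem_sum mulr_suml.
by apply: eq_bigr => j _; rewrite idemM; have [] := ht' j.
Qed.

End Separation.

(** * Computing dimensions and minima *)

Section Dimension.
Variables (K : fieldType).

(** A subspace of largest dimension inside [W] is all of [W]: a further vector of [W] would enlarge
    it. *)
Lemma vspace_of_set (vT : vectType K) (W : set vT) : W 0 ->
  (forall c u v, W u -> W v -> W (c *: u + v)) ->
  exists U : {vspace vT}, forall v, v \in U <-> W v.
Proof.
move=> W0 WP.
pose Q m := `[< exists U : {vspace vT}, (forall v, v \in U -> W v) /\ \dim U = m >].
have Q0 : exists m, Q m.
  exists 0%N; apply/asboolP; exists 0%VS; split; last by rewrite dimv0.
  by move=> v; rewrite memv0 => /eqP ->.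
have Qb m : Q m -> (m <= \dim {:vT})%N.
  by move=> /asboolP[U [_ <-]]; rewrite dimvS ?subvf.
case: (ex_maxnP Q0 Qb) => m /asboolP[U [UW dU]] mx.
exists U => v; split; first exact: UW.
move=> Wv; apply: contrapT => /negP nv.
have := mx (\dim (U + <[v]>)%VS); rewrite -dU; rewrite (_ : Q _); last first.
  apply/asboolP; exists (U + <[v]>)%VS; split => //.
  move=> _ /memv_addP[u uU [_ /vlineP[k ->] ->]].
  by rewrite addrC; apply: WP => //; apply: UW.
move=> /(_ isT); rewrite leqNgt => /negP; apply; rewrite ltn_neqAle dimvS ?addvSl // andbT.
rewrite eqn_leq negb_and dimvS ?addvSl //= -ltnNge ltnNge; apply/negP => le.
move: nv; have /eqP -> : U == (U + <[v]>)%VS by rewrite eqEdim addvSl.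
by rewrite memvE addvSr.
Qed.

(** [th] induces an isomorphism of V / W with [S]: a basis of [S] lifts to a basis modulo [W], and
    every basis modulo [W] maps to a basis of [S]. *)
Lemma dim_modE (B : comNzRingType) (c : K -> B) (V W : set B) (vT : vectType K)
    (th : B -> vT) (S : {vspace vT}) :
  (forall x y, th (x - y) = th x - th y) -> (forall a x, th (c a * x) = a *: th x) ->
  V 0 -> (forall x y, V x -> V y -> V (x - y)) -> (forall a x, V x -> V (c a * x)) ->
  (forall v, V v -> W v <-> th v = 0) ->
  (forall u, u \in S <-> exists2 v, V v & th v = u) ->
  dim_mod c V W = \dim S.
Proof.
move=> thB thZ V0 VB VZ WE SE.
have th0 : th 0 = 0 by rewrite -(subrr 0) thB subrr.
have thD x y : th (x + y) = th x + th y.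
  by rewrite -{1}[y]opprK -[- y]sub0r !thB th0 sub0r opprK.
have VD x y : V x -> V y -> V (x + y).
  by move=> Vx Vy; rewrite -[y]opprK -[- y]sub0r; apply: (VB) => //; apply: VB.
have th_sum d (a : 'I_d -> K) (e : 'I_d -> B) :
    th (\sum_i c (a i) * e i) = \sum_i a i *: th (e i).
  by elim/big_rec2: _ => // i x y _ <-; rewrite thD thZ.
have V_sum d (a : 'I_d -> K) (e : 'I_d -> B) : (forall i, V (e i)) ->
    V (\sum_i c (a i) * e i).
  by move=> Ve; apply: big_ind => // i _; apply: VZ.
have WE' d (a : 'I_d -> K) (e : 'I_d -> B) v : (forall i, V (e i)) -> V v ->
    W (v - \sum_i c (a i) * e i) <-> th v = \sum_i a i *: th (e i).
  move=> Ve Vv; rewrite WE; last by apply: VB => //; apply: V_sum.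
  rewrite thB th_sum; split=> [/eqP|->]; last by rewrite subrr.
  by rewrite subr_eq0 => /eqP.
apply: xget_unique.
  have eb (i : 'I_(\dim S)) : exists v, V v /\ th v = (vbasis S)`_i.
    have /SE[v ? ?] : (vbasis S)`_i \in S by apply: vbasis_mem; rewrite mem_nth ?size_tuple.
    by exists v.
  have [e he] := choice eb.
  exists e; split=> [i|v Vv]; first by have [] := he i.
  have Ve i : V (e i) by have [] := he i.
  have thS (a : 'I_(\dim S) -> K) :
      \sum_i a i *: th (e i) = \sum_i a i *: (vbasis S)`_i.
    by apply: eq_bigr => i _; have [_ ->] := he i.
  exists [ffun i => coord (vbasis S) i (th v)]; split.
    apply/WE' => //; rewrite thS [LHS](coord_vbasis (_ : th v \in S)); last by apply/SE; exists v.
    by apply: eq_bigr => i _; rewrite ffunE.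
  move=> a /WE'; rewrite thS => /(_ Ve Vv) ev; apply/ffunP => i; rewrite ffunE ev.
  by rewrite coord_sum_free // (basis_free (vbasisP S)).
move=> d [e [Ve hb]].
have fr : free [tuple th (e i) | i < d].
  apply/freeP => k ek.
  (* Both [k] and the zero family express 0, so uniqueness of coefficients gives freeness. *)
  have [a [_ ua]] := hb 0 V0.
  have hk : \sum_i k i *: th (e i) = 0.
    by rewrite -[RHS]ek; apply: eq_bigr => i _; rewrite -tnth_nth tnth_mktuple.
  have e1 : a = finfun k.
    apply: ua; apply/WE' => //; rewrite th0 -[LHS]hk.
    by apply: eq_bigr => i _; rewrite ffunE.
  have e2 : a = [ffun=> 0].
    apply: ua; apply/WE' => //; rewrite th0 big1 // => i _.
    by rewrite ffunE scale0r.
  by move=> i; have := congr1 (fun f : {ffun _} => f i) (etrans (esym e1) e2); rewrite !ffunE.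
have <- : (<<[tuple th (e i) | i < d]>> = S)%VS.
  apply/vspaceP => u; apply/idP/idP.
    move: u; apply/subvP/span_subvP => _ /mapP[i _ ->].
    by apply/SE; exists (e i).
  move=> /SE[v Vv <-]; have [a [/WE' ev _]] := hb v Vv; rewrite ev //.
  apply: rpred_sum => i _; apply: rpredZ; apply: memv_span.
  by apply/mapP; exists i => //; rewrite mem_enum.
by rewrite (eqP fr) size_tuple.
Qed.

Lemma nat_minP (S : set nat) m : S m ->
  S (nat_min S) /\ forall k, S k -> (nat_min S <= k)%N.
Proof.
move=> Sm; apply: (@xgetPex _ 0%N [set i | S i /\ forall k, S k -> (i <= k)%N]).
have [|i /asboolP Si mn] := @ex_minnP (fun i => `[< S i >]); first by exists m; apply/asboolP.
by exists i; split=> // k Sk; apply: mn; apply/asboolP.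
Qed.

(** The value for a set without minimum is 0, so a positive value is attained. *)
Lemma nat_min_gt0 (S : set nat) : (0 < nat_min S)%N -> S (nat_min S).
Proof.
rewrite /nat_min; case: xgetP => // y _ [Sy _] _; exact: Sy.
Qed.

End Dimension.

(** * A as a finite-dimensional vector space over K *)

Section FiniteDimension.
Variables (K : fieldType) (n : nat) (I : idealr {mpoly K[n.+1]}).
Variables (s : nat) (p : 'I_s -> projPoint I) (Ip : 'I_s -> idealr {mpoly K[n.+1]}).
Local Notation P := {mpoly K[n.+1]}.
Local Notation R := {ideal_quot I}.
Local Notation A := (germs p).
Local Notation cf := (@germ_coef K n I s p).
Local Notation constA := (@constA K n I s p).
Hypothesis H : off_hyperplane p Ip.

(* The degree i part of R, divided by x_0^i. *)
Definition Vf (i : nat) : set A := [set a | exists2 t, Rhom i t & cf i t = a].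

(** Subspaces over K, with scalars acting through [constA]. *)
Definition Asub (W : set A) : Prop :=
  [/\ W 0, forall a b, W a -> W b -> W (a + b) & forall c a, W a -> W (constA c * a)].

Definition Alin (M : lmodType K) (l : A -> M) : Prop :=
  (forall a b, l (a + b) = l a + l b) /\ (forall c a, l (constA c * a) = c *: l a).

Lemma Alin0 (M : lmodType K) (l : A -> M) : Alin l -> l 0 = 0.
Proof. by move=> [lD _]; apply: (addrI (l 0)); rewrite -lD !addr0. Qed.

Lemma AlinN (M : lmodType K) (l : A -> M) a : Alin l -> l (- a) = - l a.
Proof.
by move=> hl; apply/eqP; rewrite -addr_eq0 -(proj1 hl) addNr (Alin0 hl).
Qed.

Lemma constA_pi i c (f : P) : cf i (\pi_R (c%:MP * f)) = constA c * cf i (\pi_R f).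
Proof. by rewrite rmorphM (cf_const H). Qed.

Lemma constAE c : constA c = cf 0 (constR I c).
Proof. by rewrite (cf_hom H _ (Rhom_const I c)). Qed.

Lemma constA_D c d : constA (c + d) = constA c + constA d.
Proof. by rewrite !constAE constRD (cfD H). Qed.

Lemma constA_M c d : constA (c * d) = constA c * constA d.
Proof. by rewrite [LHS]constAE constRM (cf_const H) -constAE. Qed.

Lemma constA_1 : constA 1 = 1.
Proof. by rewrite constAE constR1 -(expr0 (x0 I)) (cf_x0X H). Qed.

Lemma constA_N1 : constA (-1) = -1.
Proof. by rewrite constAE constRN constR1 (cfN H) -(expr0 (x0 I)) (cf_x0X H). Qed.

Lemma Vf_sub i : Asub (Vf i).
Proof.
split.
- by exists 0; [exact: Rhom0 | exact: cf0 H _].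
- by move=> _ _ [a ha <-] [b hb <-]; exists (a + b); [exact: RhomD | exact: cfD H _ _ _].
- move=> c _ [a ha <-]; exists (constR I c * a); last exact: cf_const H _ _ _.
  by rewrite -[i]add0n; apply: RhomM (Rhom_const _ _) _.
Qed.

Lemma Vf_mono i k a : (i <= k)%N -> Vf i a -> Vf k a.
Proof. by move=> le [t ht <-]; have [t' ? <-] := cf_pad H le ht; exists t'. Qed.

(** By [cf_surj], A is a quotient of the space of forms of degree D; [u] is the section with values
    in a complement of the kernel. *)
Lemma A_fin_dim : exists (vT : vectType K) (u : A -> vT), Alin u /\ injective u.
Proof.
have [D /(_ D) hD] := cf_surj H.
pose V : vectType K := dhomog n.+1 K D.
pose om (w : V) : A := cf D (\pi_R (w : P)).
have omD w w' : om (w + w') = om w + om w'.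
  by rewrite /om (raddfD (@mpoly_of_dhomog n.+1 K D)) (rmorphD \pi_R) (cfD H).
have omZ c w : om (c *: w) = constA c * om w.
  by rewrite /om (linearZ_LR (@mpoly_of_dhomog n.+1 K D)) /= -mul_mpolyC constA_pi.
have om0 : om 0 = 0.
  by rewrite /om (raddf0 (@mpoly_of_dhomog n.+1 K D)) (rmorph0 \pi_R) (cf0 H).
have [U hU] : exists U : {vspace V}, forall w, w \in U <-> om w = 0.
  apply: (vspace_of_set (W := [set w | om w = 0])) => // c v w /= hv hw.
  by rewrite omD omZ hv hw mulr0 addr0.
have hu a : exists w : V, w \in (U^C)%VS /\ om w = a.
  have [_ [f hf ->] <-] := hD a (leqnn D).
  have : DHomog hf \in (U + U^C)%VS by rewrite addv_complf memvf.
  move=> /memv_addP[w /hU hw [w' hw' e]]; exists w'; split => //.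
  by rewrite -[LHS]add0r -hw -omD -e.
have [u hu'] := choice hu.
have inj w w' : w \in (U^C)%VS -> w' \in (U^C)%VS -> om w = om w' -> w = w'.
  move=> hw hw' e; apply/eqP; rewrite -subr_eq0 -memv0 -(capv_compl U) memv_cap.
  apply/andP; split; last by rewrite rpredB.
  apply/hU.
  by rewrite -scaleN1r omD omZ constA_N1 mulN1r e subrr.
exists V, u; split; last first.
  by move=> a b e; have [_ <-] := hu' a; rewrite e; have [] := hu' b.
split=> [a b|c a]; apply: inj.
- by have [] := hu' (a + b).
- by rewrite rpredD //; [have [] := hu' a | have [] := hu' b].
- by rewrite omD; have [_ ->] := hu' (a + b); have [_ ->] := hu' a; have [_ ->] := hu' b.
- by have [] := hu' (constA c * a).
- by rewrite rpredZ //; have [] := hu' a.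
- by rewrite omZ; have [_ ->] := hu' (constA c * a); have [_ ->] := hu' a.
Qed.

Lemma image_vspace (vT : vectType K) (u : A -> vT) (W : set A) : Alin u -> Asub W ->
  exists U : {vspace vT}, forall v, v \in U <-> exists2 a, W a & u a = v.
Proof.
move=> hu [W0 WD WZ].
apply: (vspace_of_set (W := [set v | exists2 a, W a & u a = v])).
  by exists 0 => //; apply: Alin0.
move=> c _ _ [a Wa <-] [b Wb <-]; exists (constA c * a + b).
  by apply: WD => //; apply: WZ.
by rewrite (proj1 hu) (proj2 hu).
Qed.

(** [l0] is composed with a projection onto [W1] that kills [W2], constructed inside [vT]. *)
Lemma functional_ext (W1 W2 : set A) (l0 : A -> K^o) : Asub W1 -> Asub W2 ->
  (forall a, W1 a -> W2 a -> a = 0) -> Alin l0 -> exists l : A -> K^o,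
  [/\ Alin l, forall a, W1 a -> l a = l0 a & forall a, W2 a -> l a = 0].
Proof.
move=> s1 s2 W12 hl; have [vT [u [hu inj]]] := A_fin_dim.
have [S1 h1] := image_vspace hu s1; have [S2 h2] := image_vspace hu s2.
have cap : (S1 :&: S2 = 0)%VS.
  apply/eqP; rewrite -subv0; apply/subvP => v; rewrite memv_cap memv0.
  move=> /andP[/h1[a Wa <-] /h2[b Wb /inj e]].
  by rewrite (W12 a) ?(Alin0 hu) // -e.
have ew v : exists a, v \in S1 -> W1 a /\ u a = v.
  case: (boolP (v \in S1)) => [/h1[a Wa e]|_]; first by exists a.
  by exists 0.
have [w hw] := choice ew.
pose pr := daddv_pi S1 S2.
have prS v : pr v \in S1 by apply: memv_pi.
have hW v : W1 (w (pr v)) by have [] := hw _ (prS v).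
have uw v : u (w (pr v)) = pr v by have [] := hw _ (prS v).
have [_ W1D W1Z] := s1.
exists (fun a => l0 (w (pr (u a)))); split.
- split=> [a b|c a].
    rewrite -(proj1 hl); congr l0; apply: inj.
    by rewrite uw !(proj1 hu) !uw raddfD.
  rewrite -(proj2 hl); congr l0; apply: inj.
  by rewrite uw !(proj2 hu) !uw linearZ.
- move=> a Wa; congr l0; apply: inj; rewrite uw; apply: daddv_pi_id => //.
  by apply/h1; exists a.
- move=> a Wa; rewrite (_ : w _ = 0) ?(Alin0 hl) //; apply: inj.
  rewrite uw (Alin0 hu); apply/eqP.
  have uS : u a \in S2 by apply/h2; exists a.
  have : u a = pr (u a) + daddv_pi S2 S1 (u a).
    by rewrite daddv_pi_add //; apply: subvP uS; apply: addvSr.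
  rewrite (daddv_pi_id _ uS) 1?capvC // => /eqP.
  by rewrite -subr_eq0 opprD addrCA subrr addr0 oppr_eq0.
Qed.

End FiniteDimension.

(** * Hilbert functions as dimensions of subspaces related to A *)

Section HilbertFunctions.
Variables (K : fieldType) (n : nat) (I : idealr {mpoly K[n.+1]}).
Variables (s : nat) (p : 'I_s -> projPoint I) (Ip : 'I_s -> idealr {mpoly K[n.+1]}).
Local Notation P := {mpoly K[n.+1]}.
Local Notation R := {ideal_quot I}.
Local Notation A := (germs p).
Local Notation cf := (@germ_coef K n I s p).
Local Notation constA := (@constA K n I s p).
Local Notation Vf := (@Vf K n I s p).
Hypothesis H : off_hyperplane p Ip.

(** The factor O_j as the ideal e_j A, so that it can be compared with the subspaces V_i. *)
Definition Aj (j : 'I_s) : set A := [set a | idem p j * a = a].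

Lemma Aj_sub j : Asub (Aj j).
Proof.
split=> [|a b|c a]; rewrite /Aj /=; first by rewrite mulr0.
  by move=> ha hb; rewrite mulrDr ha hb.
by move=> ha; rewrite mulrCA ha.
Qed.

Lemma AjE j a : Aj j a <-> a = inj_at (a j).
Proof. by rewrite /Aj /= idemM; split=> /esym. Qed.

Lemma inj_at_Aj j (a : localRing (p j)) : Aj j (inj_at a).
Proof. by apply/AjE; rewrite inj_atE. Qed.

Lemma idem_Aj j a : Aj j (idem p j * a).
Proof. by rewrite idemM; apply: inj_at_Aj. Qed.

Lemma setT_sub : Asub [set: A]. Proof. by []. Qed.

Section Embedded.
Variables (vT : vectType K) (u : A -> vT).
Hypotheses (hu : Alin u) (inj_u : injective u).

Lemma u_eq0 a : u a = 0 <-> a = 0.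
Proof. by split=> [|->]; rewrite -?(Alin0 hu) // => /inj_u. Qed.

Lemma uB a b : u (a - b) = u a - u b.
Proof. by rewrite (proj1 hu) (AlinN _ hu). Qed.

(** If [J] is cut out in degree [i] by the kernel of [th], then (P / J)_i is isomorphic to th(V_i).
    It is used with the identity for [I] and with multiplication by 1 - e_j for the ideal of Y_j. *)
Lemma HF_dim (J : {pred P}) (th : A -> A) i (S : {vspace vT}) :
  (forall a b, th (a - b) = th a - th b) ->
  (forall c a, th (constA c * a) = constA c * th a) ->
  (forall f : P, f \is i.-homog -> f \in J <-> th (cf i (\pi_R f)) = 0) ->
  (forall v, v \in S <-> exists2 a, Vf i a & u (th a) = v) -> HF J i = \dim S.
Proof.
move=> thB thZ thJ hS.
apply: (@dim_modE _ _ _ _ _ _ (fun f : P => u (th (cf i (\pi_R f))))).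
- by move=> x y; rewrite rmorphB /= (cfD H) (cfN H) thB uB.
- by move=> a x; rewrite (constA_pi H) thZ (proj2 hu).
- exact: rpred0.
- by move=> x y hx hy; apply: rpredB.
- by move=> a x hx /=; rewrite mul_mpolyC; apply: rpredZ.
- by move=> f hf; rewrite u_eq0; apply: thJ.
- move=> v; rewrite hS; split.
    by move=> [_ [_ [f hf ->] <-] <-]; exists f.
  by move=> [f hf <-]; exists (cf i (\pi_R f)) => //; exists (\pi_R f) => //; exists f.
Qed.

Lemma HF_I_dim i (S : {vspace vT}) :
  (forall v, v \in S <-> exists2 a, Vf i a & u a = v) -> HF I i = \dim S.
Proof.
move=> hS; apply: (HF_dim (th := id)) => // f hf.
have hr : Rhom i (\pi_R f : R) by exists f.
rewrite -pi_eq0; split=> [/eqP ->|e]; first exact: (cf0 H).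
by apply/eqP; apply: (cf_inj H hr).
Qed.

Lemma off_idealE j i f : f \is i.-homog ->
  f \in off_ideal Ip j <-> (1 - idem p j) * cf i (\pi_R f) = 0.
Proof.
move=> hf; have hr : Rhom i (\pi_R f : R) by exists f.
rewrite (cf_hom H _ hr) eqxx; split.
  move=> /forallP fJ; apply: germsP => k; rewrite germsM germsD germsN germs1 /idem.
  case: (eqVneq k j) => [_|ne]; first by rewrite subrr mul0r.
  have /implyP/(_ ne) fk := fJ k.
  by rewrite subr0 mul1r; apply/(germ_eq0_prim H).
move=> e; apply/forallP => k; apply/implyP => ne.
apply/(germ_eq0_prim H k hf); have := congr1 (fun a : A => a k) e.
by rewrite germsM germsD germsN germs1 /idem (negPf ne) subr0 mul1r.
Qed.

Lemma HF_off_dim j i (S : {vspace vT}) :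
  (forall v, v \in S <-> exists2 a, Vf i a & u ((1 - idem p j) * a) = v) ->
  HF (off_ideal Ip j) i = \dim S.
Proof.
move=> hS; apply: (HF_dim (th := fun a => (1 - idem p j) * a)) => //.
- by move=> a b; rewrite mulrBr.
- by move=> c a; rewrite mulrCA.
- by move=> f hf; apply: off_idealE.
Qed.

Lemma nu_dim j (S : {vspace vT}) :
  (forall v, v \in S <-> exists2 a, Aj j a & u a = v) -> nu (p j) = \dim S.
Proof.
move=> hS; apply: (@dim_modE _ _ _ _ _ _ (fun a : localRing (p j) => u (inj_at a))) => //.
- move=> x y; rewrite -uB; congr u; apply: germsP => k; rewrite germsD germsN.
  case: (eqVneq k j) => [->|ne]; first by rewrite !inj_atE.
  by rewrite !inj_at_out // subr0.
- move=> a x; rewrite -(proj2 hu); congr u; apply: germsP => k; rewrite germsM.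
  case: (eqVneq k j) => [->|ne]; first by rewrite !inj_atE.
  by rewrite !inj_at_out // mulr0.
- move=> a _; rewrite u_eq0; split=> [->|e].
    apply: germsP => k; rewrite germs0.
    by case: (eqVneq k j) => [->|ne]; rewrite ?inj_atE ?inj_at_out.
  by rewrite -[a]inj_atE e.
- move=> v; rewrite hS; split.
    by move=> [a /AjE ea <-]; exists (a j); rewrite // -ea.
  by move=> [a _ <-]; exists (inj_at a) => //; apply: inj_at_Aj.
Qed.

(** A is the direct sum of the e_j A, whose dimensions are the nu_j; multiplying a relation by e_j
    isolates its j-th term. *)
Lemma degX_dim (S : {vspace vT}) :
  (forall v, v \in S <-> exists a, u a = v) -> degX p = \dim S.
Proof.
move=> hS.
have [T hT] := choice (fun j => image_vspace hu (Aj_sub j)).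
rewrite /degX (eq_bigr (fun j => \dim (T j))) => [|j _]; last exact: nu_dim (hT j).
have u_sum (F : 'I_s -> A) : u (\sum_j F j) = \sum_j u (F j).
  by elim/big_rec2: _ => [|j a b _ <-]; rewrite ?(Alin0 hu) ?(proj1 hu).
have dir : directv (\sum_j T j).
  apply/directv_sum_independent => us husT e0 j _.
  have hF i : exists a, Aj i a /\ u a = us i by have /hT[a ? ?] := husT i isT; exists a.
  have [F {}hF] := choice hF.
  have eF i : u (F i) = us i by have [] := hF i.
  have F0 : \sum_i F i = 0.
    by apply/u_eq0; rewrite u_sum -[RHS]e0; apply: eq_bigr.
  have Fj : F j = 0.
    have [Ajj _] := hF j; rewrite -Ajj -(mulr0 (idem p j)) -F0 mulr_sumr (bigD1 j) //=.
    rewrite big1 ?addr0 // => k ne; have [/AjE -> _] := hF k.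
    apply: germsP => l; rewrite germsM /idem germs0.
    case: eqP => [->|_]; last by rewrite mul0r.
    by rewrite inj_at_out ?mulr0 // eq_sym.
  by rewrite -eF Fj (Alin0 hu).
rewrite -(directvP dir) /=; congr (\dim _); apply/vspaceP => v; apply/idP/idP.
  move=> /memv_sumP[us husT ->].
  apply: rpred_sum => j _; have /hT[a _ <-] := husT j isT.
  by apply/hS; exists a.
move=> /hS[a <-]; rewrite -[a]mul1r -(idem_sum p) mulr_suml u_sum.
apply: memv_sumr => j _; apply/hT; exists (idem p j * a) => //.
exact: idem_Aj.
Qed.

End Embedded.

(** By [cf_surj] the Hilbert function equals dim A = deg X in high degrees, so the minimum defining
    [regX] is attained. There V_i has the dimension of A. *)
Lemma regX_full a : Vf (regX p) a.
Proof.
have [vT [u [hu inj_u]]] := A_fin_dim H.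
have [T hT] := image_vspace hu setT_sub.
have dT : degX p = \dim T.
  by apply: (degX_dim hu inj_u) => v; rewrite hT; split=> [[b _ <-]|[b <-]]; exists b.
have [D hD] := cf_surj H.
have [] := @nat_minP [set r | forall i, (r <= i)%N -> HF I i = degX p] D.
  move=> i le; rewrite dT; apply: (HF_I_dim hu inj_u) => v; rewrite hT.
  split=> [[b _ <-]|[b _ <-]]; exists b => //.
  by have [t ht <-] := hD i b le; exists t.
move=> /(_ _ (leqnn _)) e _.
have [S hS] := image_vspace hu (Vf_sub H (regX p)).
have ST : S = T.
  apply/eqP; rewrite eqEdim; apply/andP; split.
    by apply/subvP => v /hS[b _ <-]; apply/hT; exists b.
  by rewrite -dT -e (HF_I_dim hu inj_u hS).
have : u a \in S by rewrite ST; apply/hT; exists a.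
by move=> /hS[b hb /inj_u <-].
Qed.

(** V_i lies in the direct sum of (1 - e_j) V_i and e_j A. The hypothesis says that the dimensions
    agree, so V_i is this sum. *)
Lemma HF_off_sub j i : ((HF (off_ideal Ip j) i + nu (p j)) = HF I i)%N ->
  Aj j `<=` Vf i.
Proof.
have [vT [u [hu inj_u]]] := A_fin_dim H.
have [T hT] := image_vspace hu (Aj_sub j).
have [S hS] := image_vspace hu (Vf_sub H i).
have [V0 VD VZ] := Vf_sub H i.
have offs : Asub [set b | exists2 a, Vf i a & (1 - idem p j) * a = b].
  split.
  - by exists 0; rewrite ?mulr0.
  - by move=> _ _ [a ha <-] [b hb <-]; exists (a + b); [exact: VD | rewrite mulrDr].
  - move=> c _ [a ha <-]; exists (constA c * a); [exact: VZ | by rewrite mulrCA].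
have [M hM] := image_vspace hu offs.
rewrite (HF_I_dim hu inj_u hS) (nu_dim hu inj_u hT).
rewrite (@HF_off_dim _ _ hu inj_u _ _ M) => [|v]; last first.
  rewrite hM; split=> [[_ [a ? <-] <-]|[a ? <-]]; first by exists a.
  by exists ((1 - idem p j) * a) => //; exists a.
have MT : (M :&: T = 0)%VS.
  apply/eqP; rewrite -subv0; apply/subvP => v; rewrite memv_cap memv0.
  move=> /andP[/hM[_ [a _ <-] <-] /hT[b hb /inj_u e]].
  have ii : idem p j * idem p j = idem p j.
    by apply: germsP => k; rewrite germsM /idem; case: eqP => _; rewrite ?mulr1 ?mulr0.
  by rewrite -e -hb e mulrA mulrBr ii mulr1 subrr mul0r (Alin0 hu).
rewrite -(dimv_disjoint_sum MT) => e.
have sub : (S <= M + T)%VS.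
  apply/subvP => _ /hS[a ha <-].
  have -> : a = (1 - idem p j) * a + idem p j * a by rewrite -mulrDl subrK mul1r.
  rewrite (proj1 hu); apply: memv_add; [apply/hM | apply/hT].
    by exists ((1 - idem p j) * a) => //; exists a.
  by exists (idem p j * a) => //; apply: idem_Aj.
have SM : S = (M + T)%VS by apply/eqP; rewrite eqEdim sub e leqnn.
move=> a ha; have : u a \in S.
  by rewrite SM; apply: (subvP (addvSr M T)); apply/hT; exists a.
by move=> /hS[b hb /inj_u <-].
Qed.

End HilbertFunctions.

(** * Local generators under conditions (a) and (b) *)

Section LocalGenerators.
Variables (K : fieldType) (n : nat) (I : idealr {mpoly K[n.+1]}).
Variables (s : nat) (p : 'I_s -> projPoint I) (Ip : 'I_s -> idealr {mpoly K[n.+1]}).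
Local Notation P := {mpoly K[n.+1]}.
Local Notation R := {ideal_quot I}.
Local Notation A := (germs p).
Local Notation cf := (@germ_coef K n I s p).
Local Notation constA := (@constA K n I s p).
Local Notation Vf := (@Vf K n I s p).
Hypothesis H : off_hyperplane p Ip.

Variable tr : A -> K^o.
Hypothesis tr_lin : Alin tr.
Hypothesis tr_rep : forall l : A -> K^o, Alin l -> exists g, forall a, l a = tr (g * a).
Hypothesis tr_nd : forall g, (forall a, tr (g * a) = 0) -> g = 0.

(* In degree [i] the ideal e_j A of A lies in the conductor, while [g] lies in
   the complementary module in degree [-i] and is a unit at [p j]. *)
Definition local_generator (j : 'I_s) : Prop := exists i (g y : A),
  [/\ forall a, Vf i (idem p j * a),
      forall m v, (m < i)%N -> Vf m v -> tr (g * v) = 0 & y * g = idem p j].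

Lemma Alin_tr g : Alin (fun a => tr (g * a)).
Proof.
by split=> [a b|c a]; [rewrite mulrDr (proj1 tr_lin) | rewrite mulrCA (proj2 tr_lin)].
Qed.

Lemma CB_local_generator j : degX_at p j = regX p -> local_generator j.
Proof.
(* If r_X = 0 then V_0 = A, the orthogonality condition is empty, and g = 1 serves. *)
move=> e; case: (posnP (regX p)) => [r0|rgt0].
  exists 0%N, 1, (idem p j); split; rewrite ?mulr1 // => a.
  by rewrite -r0; apply: (regX_full H).
exists (regX p).
(* Positivity excludes the default value of [nat_min], so some maximal subscheme attains the
   minimum. *)
have : (0 < degX_at p j)%N by rewrite e.
move=> /nat_min_gt0 [J _ [t [b [t0 soc _ _ em]]]].
have [k ek] : exists k, mu (b k * t) = regX p.
  have : (0 < \max_(k < kappa (p j)) mu (b k * t)%R)%N by rewrite -em -/(degX_at p j) e.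
  rewrite -/(degX_at p j) e in em *; case: (posnP (kappa (p j))) => [k0|kgt0 _].
    rewrite big1 // => k _; have := ltn_ord k; rewrite {2}k0; case: (k : nat) => //.
  have card : (0 < #|'I_(kappa (p j))|)%N by rewrite card_ord.
  have [k ek] := eq_bigmax (fun k => mu (b k * t)%R) card.
  by exists k; rewrite -ek em.
pose z := b k * t.
(* Otherwise mu(z) would be at most r_X - 1. *)
have nV : ~ Vf (regX p).-1 (inj_at z).
  move=> [r hr er].
  have Sz : exists r : R, itilde (p j) r = z *: 'X^((regX p).-1) /\
                     forall k, k != j -> itilde (p k) r = 0.
    have cr l i : (itilde (p l) r)`_i = if i == (regX p).-1 then inj_at z l else 0.
      rewrite (itilde_coef H) (cf_hom H _ hr) -er (cf_hom H _ hr) eqxx.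
      by case: eqP.
    exists r; split=> [|l ne]; apply/polyP => i; rewrite cr.
      by rewrite coefZ coefXn inj_atE; case: eqP => _; rewrite ?mulr1 ?mulr0.
    by rewrite inj_at_out // coef0 if_same.
  have [_ /(_ _ Sz)] := @nat_minP [set i | exists r : R, itilde (p j) r = z *: 'X^i /\
                     forall k, k != j -> itilde (p k) r = 0] _ Sz.
  by rewrite -/(mu z) ek leqNgt prednK // leqnn.
have z0 : inj_at z != 0.
  by apply/eqP => z0; apply: nV; rewrite z0; have [] := Vf_sub H (regX p).-1.
have [y0 hy0] : exists y, tr (y * inj_at z) != 0.
  apply: contrapT => /forallNP h; case/eqP: z0; apply: tr_nd => a.
  by have /negP := h a; rewrite negbK mulrC => /eqP.
pose W1 : set A := [set a | exists c, a = constA c * inj_at z].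
have W1s : Asub W1.
  split.
  - by exists 0; rewrite (constAE H) constR0 (cf0 H) mul0r.
  - by move=> _ _ [c ->] [d ->]; exists (c + d); rewrite (constA_D H) mulrDl.
  - by move=> c _ [d ->]; exists (c * d); rewrite (constA_M H) mulrA.
have W12 a : W1 a -> Vf (regX p).-1 a -> a = 0.
  move=> [c ->] hV; case: (eqVneq c 0) => [->|c0].
    by rewrite (constAE H) constR0 (cf0 H) mul0r.
  case: nV; have [_ _ VZ] := Vf_sub H (regX p).-1.
  rewrite -[inj_at z]mul1r -(constA_1 H) -(mulVf c0) (constA_M H) -mulrA.
  exact: VZ.
(* The form agrees with tr(y0 -) on the line K z, where it is nonzero at z, and vanishes on
   V_(r-1). *)
have [l [hl l1 l2]] := functional_ext H W1s (Vf_sub H _) W12 (Alin_tr y0).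
have [g hg] := tr_rep hl.
have gz : g * inj_at z != 0.
  apply: contraNneq hy0 => gz0.
  rewrite -(l1 (inj_at z)) ?hg ?gz0 ?(Alin0 tr_lin) //.
  by exists 1; rewrite (constA_1 H) mul1r.
(* A non-unit at [p j] would annihilate the socle element [t], hence z, whereas g z is nonzero. *)
have [c hc] : exists c, g j * c = 1.
  apply: contrapT => nu; case/eqP: gz; apply: germsP => k'; rewrite germsM germs0.
  case: (eqVneq k' j) => [->|ne]; last by rewrite inj_at_out // mulr0.
  by rewrite inj_atE /z mulrCA (soc _ nu) mulr0.
exists g, (inj_at c); split=> [a|m v lt hv|].
- exact: (regX_full H).
- by rewrite -hg; apply: l2; apply: (Vf_mono H _ hv); rewrite -ltnS prednK.
- apply: germsP => k'; rewrite germsM /idem; case: eqP => [->|/eqP ne].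
    by rewrite inj_atE mulrC.
  by rewrite inj_at_out // mul0r.
Qed.

Lemma HF_local_generator j : HF_condition p Ip -> local_generator j.
Proof.
move=> /(_ j) hc; pose J := off_ideal Ip j; pose i := alpha I J.
exists i.
have Ai : Aj j `<=` Vf i.
  (* At i = alpha the second case of the Hilbert function applies. *)
  apply: (HF_off_sub H); have := hc i; rewrite /= ltnn => e.
  by apply/eqP; rewrite -eqz_nat PoszD [X in X + _]e subrK.
(* An element of V_k in e_j A comes from a form of degree k in the ideal of Y_j, which is zero in R
   below the initial degree. *)
have W12 k a : (k < i)%N -> Aj j a -> Vf k a -> a = 0.
  move=> lt /AjE ha [_ [f hf ->] ea].
  have hr : Rhom k (\pi_R f : R) by exists f.
  case: (eqVneq (\pi_R f : R) 0) => [f0|nz]; first by rewrite -ea f0 (cf0 H).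
  have Sk : exists f : P, [/\ f \is k.-homog, f \in J & \pi_R f != 0].
    exists f; split=> //; apply/(off_idealE H j hf).
    by rewrite ea ha mulrBl mul1r idemM inj_atE subrr.
  have [_ /(_ _ Sk)] := @nat_minP [set i | exists f : P,
    [/\ f \is i.-homog, f \in J & \pi_R f != 0]] k Sk.
  by rewrite -/(alpha I J) -/i leqNgt lt.
(* This is V_(i-1), written so as to be 0 when i = 0. *)
pose W2 : set A := [set a | exists2 k, (k < i)%N & Vf k a] `|` [set 0].
have W2s : Asub W2.
  split; first by right.
    move=> a b [[k lt ha]|->] [[k' lt' hb]|->]; rewrite ?add0r ?addr0;
      try by [right|left; exists k|left; exists k'].
    left; exists (maxn k k'); first by rewrite gtn_max lt.
    have [_ VD _] := Vf_sub H (maxn k k').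
    by apply: VD; [apply: (Vf_mono H _ ha) | apply: (Vf_mono H _ hb)];
      rewrite ?leq_maxl ?leq_maxr.
  move=> c a [[k lt ha]|->]; last by right; rewrite mulr0.
  by left; exists k => //; have [_ _ VZ] := Vf_sub H k; apply: VZ.
have W a : Aj j a -> W2 a -> a = 0.
  by move=> ha [[k lt hk]|//]; apply: W12 hk.
have [l [hl l1 l2]] := functional_ext H (Aj_sub p j) W2s W tr_lin.
have [g hg] := tr_rep hl.
exists g, (idem p j); split=> [a|m v lt hv|].
- by apply: Ai; apply: idem_Aj.
- by rewrite -hg; apply: l2; left; exists m.
(* On e_j A the form represented by g is [tr] itself, so e_j g - e_j is orthogonal to A. *)
- apply/eqP; rewrite -subr_eq0; apply/eqP; apply: tr_nd => a.
  have -> : (idem p j * g - idem p j) * a = g * (idem p j * a) - idem p j * a.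
    by rewrite mulrBl [g * _]mulrCA mulrA.
  rewrite (proj1 tr_lin) (AlinN _ tr_lin) -hg l1 ?subrr //.
  exact: idem_Aj.
Qed.

End LocalGenerators.

(** * Fractions with denominator a power of x_0, and extension of forms from A to Q^h(R) *)

Section HomogeneousFractions.
Variables (K : fieldType) (n : nat) (I : idealr {mpoly K[n.+1]}).
Variables (s : nat) (p : 'I_s -> projPoint I) (Ip : 'I_s -> idealr {mpoly K[n.+1]}).
Local Notation P := {mpoly K[n.+1]}.
Local Notation R := {ideal_quot I}.
Local Notation x0 := (x0 I).
Local Notation hcomp := (@hcomp K n I).
Local Notation A := (germs p).
Local Notation cf := (@germ_coef K n I s p).
Local Notation constA := (@constA K n I s p).
Hypothesis H : off_hyperplane p Ip.

Lemma fracQ_eqP a b c d : b \in dens_h I -> d \in dens_h I ->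
  fracQ a b = fracQ c d :> Qh I <-> a * d = c * b.
Proof.
move=> bS dS; split; last exact: lfrac_eq.
move=> /eqP/(lfrac_eqP a c bS dS)[u /asboolP[_ uz] /uz/eqP].
by rewrite subr_eq0 => /eqP.
Qed.

Definition fx (r : R) (k : nat) : Qh I := fracQ r (x0 ^+ k).

Lemma fx_eqP r k r' k' : fx r k = fx r' k' <-> r * x0 ^+ k' = r' * x0 ^+ k.
Proof. by apply: fracQ_eqP; apply: (x0X_hnzd H). Qed.

Lemma fx_inj r r' k : fx r k = fx r' k -> r = r'.
Proof.
move/fx_eqP => /eqP; rewrite -subr_eq0 -mulrBl mulrC => /eqP /(x0X_nzd H).
by move=> /eqP; rewrite subr_eq0 => /eqP.
Qed.

Lemma fxM r k r' k' : fx r k * fx r' k' = fx (r * r') (k + k').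
Proof. by rewrite /fx /fracQ lfracM ?(x0X_hnzd H) // exprD. Qed.

Lemma fxD r r' k : fx r k + fx r' k = fx (r + r') k.
Proof. by rewrite /fx /fracQ lfracDl // (x0X_hnzd H). Qed.

Lemma fx0 k : fx 0 k = 0.
Proof. by rewrite /fx /fracQ lfrac0 // (x0X_hnzd H). Qed.

Lemma fxK j r k : fx (x0 ^+ j * r) (j + k) = fx r k.
Proof. by apply/fx_eqP; rewrite exprD; ring. Qed.

Lemma fx_sum (T : Type) (l : seq T) (Q : pred T) (F : T -> R) k :
  fx (\sum_(i <- l | Q i) F i) k = \sum_(i <- l | Q i) fx (F i) k.
Proof. by elim/big_rec2: _ => [|i x y _ <-]; rewrite ?fx0 ?fxD. Qed.

Lemma fx_xx k : fx (x0 ^+ k) k = 1.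
Proof.
rewrite -(mulr1 (x0 ^+ k)) -{2}[k]addn0 fxK /fx expr0 /fracQ.
exact: lfrac11.
Qed.

Lemma fracQ_fx a b d : b \in dens_h I -> Rhom d b -> exists e c,
  Rhom e c /\ fracQ a b = fx (a * c) (d + e).
Proof.
move=> bS hb; have [e [c [hc ec]]] := hnzd_dvd_x0 H bS hb.
exists e, c; split => //; apply/fracQ_eqP => //; first exact: (x0X_hnzd H).
by rewrite -ec; ring.
Qed.

Lemma Qh_fx (q : Qh I) : exists r k, q = fx r k.
Proof.
have [a [b [bS ->]]] := loc_frac q; have /asboolP[[d hb] _] := bS.
by have [e [c [_ e1]]] := fracQ_fx a bS hb; exists (a * c), (d + e)%N.
Qed.

Lemma constA_inj c d : constA c = constA d -> c = d.
Proof.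
rewrite !(constAE H) => e; apply/eqP; rewrite -subr_eq0; apply/eqP.
apply: (@constR_eq0 _ _ I); rewrite constRD constRN.
apply: (cf_inj H (d := 0%N)); last by rewrite (cfD H) (cfN H) e subrr.
by apply: RhomB; apply: Rhom_const.
Qed.

Lemma cf_poly N (c : nat -> K) i :
  cf i (\sum_(k < N) constR I (c k) * x0 ^+ k) = if (i < N)%N then constA (c i) else 0.
Proof.
rewrite (cf_sum H).
have cfi k : cf i (constR I (c k) * x0 ^+ k) = if i == k then constA (c i) else 0.
  rewrite (cf_const H); case: eqP => [<-|/eqP ne]; first by rewrite (cf_x0X H) mulr1.
  by rewrite (cf_hom H _ (Rhom_x0X I k)) (negPf ne) mulr0.
case: ltnP => [lti|lei].
  rewrite (bigD1 (Ordinal lti)) //= cfi eqxx big1 ?addr0 // => k ne.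
  by rewrite cfi; case: eqP => // e; case/eqP: ne; apply: val_inj.
by rewrite big1 => // k _; rewrite cfi gtn_eqF // (leq_trans (ltn_ord k)).
Qed.

Lemma cf_eq (r r' : R) : (forall i, cf i r = cf i r') -> r = r'.
Proof.
move=> h; apply/eqP; rewrite -subr_eq0; apply/eqP; apply: (cf_eq0 H) => i.
by rewrite (cfD H) (cfN H) h subrr.
Qed.

Lemma cf_ge i r : (msize (repr r) <= i)%N -> cf i r = 0.
Proof. by move=> le; rewrite -(cf_hcomp H) hcomp_ge // (cf0 H). Qed.

Lemma constA_0 : constA 0 = 0.
Proof. by rewrite (constAE H) constR0 (cf0 H). Qed.

Lemma Kx0P r : Kx0 r <-> forall i, exists c, cf i r = constA c.
Proof.
split.
  move=> [c ->] i; rewrite (cf_poly _ (nth 0 c)).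
  by case: ltnP => _; [exists c`_i | exists 0; rewrite constA_0].
move=> /choice[c hc]; pose C := \poly_(i < msize (repr r)) c i.
exists C; apply: cf_eq => i; rewrite (cf_poly _ (nth 0 C)).
case: ltnP => [lti|lei].
  rewrite coef_poly ifT -?hc //.
  by apply: leq_trans lti _; apply: size_poly.
have := hc i; have := nth_default 0 lei; rewrite coef_poly.
by case: ltnP => [_ ->|le _ _]; [rewrite constA_0 | rewrite cf_ge].
Qed.

(* The L_0-linear extension of [l : A -> K], in numerators. *)
Definition rho (l : A -> K^o) (r : R) : R :=
  \sum_(i < msize (repr r)) constR I (l (cf i r)) * x0 ^+ i.

Lemma cf_rho l i r : Alin l -> cf i (rho l r) = constA (l (cf i r)).
Proof.
move=> hl; rewrite (cf_poly _ (fun k => l (cf k r))); case: ltnP => // le.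
by rewrite cf_ge // (Alin0 hl) constA_0.
Qed.

Section LinearExtension.
Variable (l : A -> K^o).
Hypothesis hl : Alin l.

Lemma rhoD r r' : rho l (r + r') = rho l r + rho l r'.
Proof.
apply: cf_eq => i; rewrite (cfD H) !cf_rho // (cfD H) (proj1 hl).
exact: (constA_D H).
Qed.

Lemma rhoKx0 a r : Kx0 a -> rho l (a * r) = a * rho l r.
Proof.
have rho_sum (T : Type) (q : seq T) (F : T -> R) :
    rho l (\sum_(i <- q) F i) = \sum_(i <- q) rho l (F i).
  elim/big_rec2: _ => [|i x y _ <-]; last exact: rhoD.
  apply: cf_eq => i.
  by rewrite cf_rho // (cf0 H) (Alin0 hl) constA_0.
move=> [c ->]; rewrite !mulr_suml rho_sum; apply: eq_bigr => k _.
have hk : Rhom k (constR I c`_k * x0 ^+ k).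
  by rewrite -[X in Rhom X]add0n; apply: RhomM (Rhom_const _ _) (Rhom_x0X _ _).
apply: cf_eq => i; rewrite cf_rho //.
have [le|lt] := leqP k i; last first.
  by rewrite !(cfM_lt H _ hk lt) (Alin0 hl) constA_0.
rewrite -(subnKC le) !(cfM H _ _ hk) (cf_const H) (cf_x0X H) mulr1 cf_rho //.
by rewrite (proj2 hl) [LHS](constA_M H).
Qed.

Lemma Kx0_x0X k : Kx0 (x0 ^+ k).
Proof.
apply/Kx0P => i; rewrite (cf_hom H _ (Rhom_x0X I k)); case: eqP => _.
  by exists 1; rewrite (constA_1 H) -(cf_x0X H k) (cf_hom H _ (Rhom_x0X I k)) eqxx.
by exists 0; rewrite constA_0.
Qed.

Lemma rho_x0X k r : rho l (x0 ^+ k * r) = x0 ^+ k * rho l r.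
Proof. by apply: rhoKx0; apply: Kx0_x0X. Qed.

Lemma Kx0_rho r : Kx0 (rho l r).
Proof. by apply/Kx0P => i; exists (l (cf i r)); rewrite cf_rho. Qed.

Lemma Rhom_rho d r : Rhom d r -> Rhom d (rho l r).
Proof.
move=> hr; suff -> : rho l r = hcomp d (rho l r) by apply: Rhom_hcomp.
apply: cf_eq => i; have [->|/eqP ne] := eqVneq i d; first by rewrite (cf_hcomp H).
rewrite (cf_hom H _ (Rhom_hcomp d _)) ifN; last exact/eqP.
rewrite cf_rho // (cf_hom H _ hr) ifN; last exact/eqP.
by rewrite (Alin0 hl) constA_0.
Qed.

(** [rho l] commutes with powers of x_0, so applying it to numerators does not depend on the
    fraction chosen. The basis property of [sigma] thus becomes applicable to forms on A. *)
Lemma linear_extension : exists psi : Qh I -> Qh I,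
  graded_hom (Qgr (I := I)) (L0 (I := I)) psi /\ forall r k, psi (fx r k) = fx (rho l r) k.
Proof.
have ex (q : Qh I) : exists q', exists r k, q = fx r k /\ q' = fx (rho l r) k.
  by have [r [k e]] := Qh_fx q; exists (fx (rho l r) k), r, k.
have [psi hpsi] := choice ex.
have psiE r k : psi (fx r k) = fx (rho l r) k.
  have [r' [k' [/fx_eqP e ->]]] := hpsi (fx r k); apply/fx_eqP.
  rewrite ![rho l _ * _]mulrC -!rho_x0X; congr (rho l _).
  by rewrite mulrC -e mulrC.
exists psi; split => //; exists 1%N, (fun=> 0), (fun=> psi); split=> [_|x]; last first.
  by rewrite big_ord1.
split; first split.
- move=> x; have [r [k ->]] := Qh_fx x; rewrite psiE.
  by exists (rho l r), k; split => //; apply: Kx0_rho.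
- move=> _ x y [a [k [ha ->]]]; have [r [m ->]] := Qh_fx x.
  have [r' [m' ->]] := Qh_fx y; rewrite -!/(fx _ _) !psiE !fxM.
  rewrite -[fx (a * r) _](fxK m') -[fx r' m'](fxK (k + m)) [(k + m + m')%N]addnC fxD psiE.
  rewrite rhoD !rho_x0X rhoKx0 // -fxD fxK; congr (_ + _).
  by rewrite [(m' + _)%N]addnC fxK.
- move=> i _ [d [e [a [b [ha hb bS -> ->]]]]].
  have [e' [c [hc ->]]] := fracQ_fx a bS hb; rewrite psiE addr0.
  exists (d + e')%N, (e + e')%N, (rho l (a * c)), (x0 ^+ (e + e')); split => //.
  + by apply: Rhom_rho; apply: RhomM.
  + exact: Rhom_x0X.
  + exact: (x0X_hnzd H).
  + by rewrite !PoszD; ring.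
Qed.

End LinearExtension.
End HomogeneousFractions.

(** * The nondegenerate form on A underlying the trace map *)

Section TraceForm.
Variables (K : fieldType) (n : nat) (I : idealr {mpoly K[n.+1]}).
Variables (s : nat) (p : 'I_s -> projPoint I) (Ip : 'I_s -> idealr {mpoly K[n.+1]}).
Local Notation P := {mpoly K[n.+1]}.
Local Notation R := {ideal_quot I}.
Local Notation x0 := (x0 I).
Local Notation hcomp := (@hcomp K n I).
Local Notation A := (germs p).
Local Notation cf := (@germ_coef K n I s p).
Local Notation constA := (@constA K n I s p).
Hypothesis H : off_hyperplane p Ip.
Local Notation rho := (@rho K n I s p).
Variable sigma : Qh I -> Qh I.
Hypothesis sigmaT : trace_map sigma.

Lemma L0_fx k m : L0 (fx (x0 ^+ k) m : Qh I).
Proof. by exists (x0 ^+ k), m; split => //; apply: (Kx0_x0X H). Qed.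

Lemma L0_const c : L0 (fx (constR I c) 0 : Qh I).
Proof.
exists (constR I c), 0%N; split=> //; apply/(Kx0P H) => i.
rewrite (cf_hom H _ (Rhom_const I c)); case: eqP => _; first by exists c.
by exists 0; rewrite (constA_0 H).
Qed.

Lemma sigmaP a x y : L0 a -> sigma (a * x + y) = a * sigma x + sigma y.
Proof. by have [[[_ h] _] _] := sigmaT; apply: h. Qed.

Lemma sigmaD x y : sigma (x + y) = sigma x + sigma y.
Proof.
have := sigmaP x y (L0_fx 0 0); rewrite (fx_xx H) !mul1r; exact.
Qed.

Lemma sigma0 : sigma 0 = 0.
Proof. by apply: (addrI (sigma 0)); rewrite -sigmaD !addr0. Qed.

Lemma sigmaZ a x : L0 a -> sigma (a * x) = a * sigma x.
Proof. by move=> ha; rewrite -[a * x]addr0 sigmaP // sigma0 addr0. Qed.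

(** [sigma] preserves degrees, and the degree 0 part of L_0 is K. *)
Lemma sigma_deg0 d r : Rhom d r -> exists c, sigma (fx r d) = fx (constR I c) 0.
Proof.
move=> hr; have [[[sL _] sG] _] := sigmaT.
have : Qgr (0 + 0) (sigma (fx r d)).
  apply: sG; exists d, d, r, (x0 ^+ d); split=> //; [exact: Rhom_x0X | | by rewrite subrr].
  exact: (x0X_hnzd H).
have [a [k [ha ->]]] := sL (fx r d); rewrite -/(fx a k) addr0.
move=> [d1 [e [b [b' [hb hb' bS' /esym/eqP e0]]]]].
move=> /(fracQ_eqP _ _ (x0X_hnzd H k) bS').
have {e0} ed : d1 = e by apply/eqP; move: e0; rewrite subr_eq0.
rewrite {d1}ed in hb *; move=> eab.
have [c hc] := iffLR (Kx0P H a) ha k.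
exists c; apply/(fx_eqP H); rewrite expr0 mulr1; apply: (cf_eq H) => i.
rewrite (cf_const H) (cf_hom H _ (Rhom_x0X I k)).
case: eqP => [->|/eqP ne].
  by rewrite hc -[LHS]mulr1 -(cf_x0X H k) (cf_hom H _ (Rhom_x0X I k)) eqxx.
rewrite mulr0 -(cf_hcomp H).
(* The product b' a = b x_0^k is homogeneous and b' is a homogeneous non-zerodivisor, so [a] is
   homogeneous of degree k. *)
suff -> : hcomp i a = 0 by rewrite (cf0 H).
have /asboolP[_ nz] := bS'; apply: nz.
rewrite -(hcompM (homogI H) _ _ hb') mulrC eab.
rewrite (hcomp_Rhom (homogI H) _ (RhomM hb (Rhom_x0X _ _))).
by rewrite eqn_add2l (negPf ne).
Qed.

Lemma fx_const_inj c c' : fx (constR I c) 0 = fx (constR I c') 0 -> c = c'.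
Proof.
move=> /(fx_inj H) e; apply: (constA_inj H); by rewrite !(constAE H) e.
Qed.

Definition trace_of (tr : A -> K^o) : Prop :=
  Alin tr /\ forall r k, sigma (fx r k) = fx (rho tr r) k.

(** The values of [tr] are read off in one degree D in which every element of A is realized;
    multiplying by powers of x_0 transfers them to all degrees. *)
Lemma trace_of_exists : exists tr, trace_of tr.
Proof.
have [D /(_ D) hD] := cf_surj H.
have ex (a : A) : exists c : K^o, exists t, [/\ Rhom D t, cf D t = a &
    sigma (fx t D) = fx (constR I c) 0].
  have [t ht et] := hD a (leqnn D); have [c hc] := sigma_deg0 ht.
  by exists c, t.
have [tr htr] := choice ex; exists tr.
have trE d r : Rhom d r -> sigma (fx r d) = fx (constR I (tr (cf d r))) 0.
  move=> hr; have [t [ht et <-]] := htr (cf d r); congr sigma; apply/(fx_eqP H).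
  apply/eqP; rewrite -subr_eq0; apply/eqP; apply: (cf_inj H (d := (D + d)%N)).
    by apply: RhomB; [rewrite addnC|]; apply: RhomM => //; apply: Rhom_x0X.
  rewrite (cfD H) (cfN H) mulrC (cf_x0XM H) [t * _]mulrC [(D + d)%N]addnC (cf_x0XM H) et.
  by rewrite subrr.
have lin : Alin tr.
  split=> [a b|c a]; apply: fx_const_inj.
    have [t [ht et _]] := htr a; have [t' [ht' et' _]] := htr b.
    rewrite -et -et' -(cfD H) -(trE _ _ (RhomD ht ht')) -(fxD H) sigmaD !trE //.
    by rewrite (fxD H) constRD.
  have [t [ht et _]] := htr a.
  have hct : Rhom D (constR I c * t).
    by rewrite -[D]add0n; apply: RhomM (Rhom_const _ _) ht.
  rewrite -et -(cf_const H) -(trE _ _ hct).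
  rewrite -[D]add0n -(fxM H) sigmaZ; last exact: L0_const.
  by rewrite add0n trE // (fxM H) -constRM.
split => // r k; rewrite {1}[r]Rhom_sum (fx_sum H).
have sig_sum (T : Type) (q : seq T) (F : T -> Qh I) :
    sigma (\sum_(i <- q) F i) = \sum_(i <- q) sigma (F i).
  by elim/big_rec2: _ => [|i x y _ <-]; [exact: sigma0 | exact: sigmaD].
rewrite sig_sum /rho (fx_sum H); apply: eq_bigr => i _.
have -> : fx (hcomp i r) k = fx (x0 ^+ i) k * fx (hcomp i r) i.
  by rewrite (fxM H) [(k + i)%N]addnC (fxK H).
rewrite sigmaZ; last exact: L0_fx.
rewrite (trE _ _ (Rhom_hcomp i r)) (fxM H) addn0 (cf_hcomp H) mulrC.
by [].
Qed.

Variable tr : A -> K^o.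
Hypothesis trT : trace_of tr.

(** Both 0 and [q] represent the zero map, and representatives are unique. *)
Lemma sigma_eq0 q : (forall y, sigma (q * y) = 0) -> q = 0.
Proof.
move=> hq; have [_ /(_ (fun=> 0))[]] := sigmaT.
  exists 0%N, (fun=> 0), (fun _ _ => 0); split=> [[]//|x]; by rewrite big_ord0.
move=> g [_ ug]; have <- : g = q by apply: ug => y; rewrite hq.
by apply: ug => y; rewrite mul0r sigma0.
Qed.

(** For a form [t] lifting such a [g], the multiple (t / x_0^D) sigma is zero. *)
Lemma tr_nondegenerate g : (forall a, tr (g * a) = 0) -> g = 0.
Proof.
move=> hg; have [D /(_ D g (leqnn D))[t ht et]] := cf_surj H.
suff t0 : t = 0 by rewrite -et t0 (cf0 H).
apply: (fx_inj H (k := D)); rewrite (fx0 H); apply: sigma_eq0 => y.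
have [r [k ->]] := Qh_fx H y; rewrite (fxM H) (proj2 trT).
rewrite (_ : rho tr _ = 0) ?(fx0 H) //; apply: (cf_eq0 H) => i.
rewrite (cf_rho H _ _ (proj1 trT)); have [le|lt] := leqP D i; last first.
  by rewrite (cfM_lt H _ ht lt) (Alin0 (proj1 trT)) (constA_0 H).
by rewrite -(subnKC le) (cfM H _ _ ht) et hg (constA_0 H).
Qed.

(** The extension of [l] equals q sigma for some q in Q^h(R); the degree 0 coefficient of q
    represents [l]. *)
Lemma tr_represents (l : A -> K^o) : Alin l -> exists g, forall a, l a = tr (g * a).
Proof.
move=> hl; have [psi [hpsi psiE]] := linear_extension H hl.
have [_ /(_ _ hpsi)[q [hq _]]] := sigmaT.
have [r [k eq]] := Qh_fx H q; exists (cf k r) => a.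
have [D /(_ D a (leqnn D))[t ht et]] := cf_surj H.
have := hq (fx t D); rewrite psiE eq (fxM H) (proj2 trT) => /(fx_eqP H).
move/(congr1 (cf (D + (k + D)))); rewrite mulrC [rho tr _ * _]mulrC.
rewrite [in LHS]addnC !(cf_x0XM H) !(cf_rho H) //; last exact: (proj1 trT).
rewrite et [(k + D)%N]addnC mulrC (cfM H _ _ ht) et [a * _]mulrC.
exact: (constA_inj H).
Qed.

End TraceForm.

(** * R~, the conductor and the complementary module in coordinates *)

Section Conductor.
Variables (K : fieldType) (n : nat) (I : idealr {mpoly K[n.+1]}).
Variables (s : nat) (p : 'I_s -> projPoint I) (Ip : 'I_s -> idealr {mpoly K[n.+1]}).
Local Notation P := {mpoly K[n.+1]}.
Local Notation R := {ideal_quot I}.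
Local Notation x0 := (x0 I).
Local Notation hcomp := (@hcomp K n I).
Local Notation A := (germs p).
Local Notation cf := (@germ_coef K n I s p).
Local Notation constA := (@constA K n I s p).
Local Notation Vf := (@Vf K n I s p).
Local Notation it j := (itilde (p j)).
Hypothesis H : off_hyperplane p Ip.
Local Notation rho := (@rho K n I s p).

Lemma polyXn_inj (B : comNzRingType) k (a b : {poly B}) : 'X^k * a = 'X^k * b -> a = b.
Proof.
move=> e; apply/polyP => i; have := congr1 (fun f : {poly B} => f`_(i + k)) e.
by rewrite !coefXnM ltnNge leq_addl addnK.
Qed.

Lemma itilde_inj r r' : (forall j, it j r = it j r') -> r = r'.
Proof.
by move=> h; apply: (cf_eq H) => i; apply: germsP => j; rewrite -!(itilde_coef H) h.
Qed.

Lemma itilde_homM j d t r : Rhom d t -> it j (t * r) = (cf d t j *: 'X^d) * it j r.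
Proof.
move=> ht; apply/polyP => i; rewrite -scalerAl coefZ coefXnM !(itilde_coef H).
case: ltnP => [lt|le]; first by rewrite (cfM_lt H _ ht lt) mulr0.
by rewrite -{1}(subnKC le) (cfM H _ _ ht).
Qed.

Lemma itilde1 j : it j 1 = 1.
Proof.
apply/polyP => i; rewrite (itilde_coef H) coef1.
rewrite -(expr0 x0) (cf_hom H _ (Rhom_x0X I 0)); case: eqP => // _.
by rewrite (germ_x0X (X0notin H j)).
Qed.

Lemma itilde_hom j d t : Rhom d t -> it j t = cf d t j *: 'X^d.
Proof. by move=> ht; rewrite -[t]mulr1 (itilde_homM _ _ ht) itilde1 !mulr1. Qed.

Lemma itilde_x0X j k : it j (x0 ^+ k) = 'X^k.
Proof. by rewrite (itilde_hom _ (Rhom_x0X I k)) (cf_x0X H) scale1r. Qed.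

Lemma itilde_sum j (T : Type) (l : seq T) (Q : pred T) (F : T -> R) :
  it j (\sum_(i <- l | Q i) F i) = \sum_(i <- l | Q i) it j (F i).
Proof.
elim/big_rec2: _ => [|i a b _ <-]; apply/polyP => k.
  by rewrite (itilde_coef H) coef0 (cf0 H).
by rewrite coefD !(itilde_coef H) (cfD H).
Qed.

Lemma itildeM j a b : it j (a * b) = it j a * it j b.
Proof.
rewrite [a]Rhom_sum mulr_suml !itilde_sum mulr_suml; apply: eq_bigr => i _.
by rewrite (itilde_homM _ _ (Rhom_hcomp i a)) (itilde_hom _ (Rhom_hcomp i a)).
Qed.

(** The fraction hidden in [extends_itilde] may be any one: its denominator divides a power of x_0,
    which maps to a cancellable power of T. *)
Lemma extends_fx r k (h : Rtilde p) :
  extends_itilde (fx r k) h <-> forall j, it j r = 'X^k * h j.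
Proof.
split=> [[a [b [bS e eh]]] j|eh].
  move/(fracQ_eqP _ _ (x0X_hnzd H k) bS) : e => e.
  have /asboolP[[d hb] _] := bS; have [m [c [hc ec]]] := hnzd_dvd_x0 H bS hb.
  apply: (polyXn_inj (k := (d + m)%N)).
  have := congr1 (itilde (p j)) e; rewrite !itildeM itilde_x0X eh => ej.
  rewrite -(itilde_x0X j (d + m)) -ec [b * c]mulrC itildeM -!mulrA; congr (_ * _).
  by rewrite [LHS]mulrC ej -mulrA [h j * _]mulrC.
exists r, (x0 ^+ k); split=> [||j]; [exact: (x0X_hnzd H) | by [] |].
by rewrite itilde_x0X.
Qed.

(** The coefficient of T^m in [h] lies in V_i, hence in V_(i+m), and so comes from a form of degree
    i + m. *)
Lemma realize i (h : Rtilde p) : (forall m, Vf i (fun j => (h j)`_m)) ->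
  exists r, forall j, it j r = 'X^i * h j.
Proof.
move=> hV.
have ex m : exists t, Rhom (i + m) t /\ cf (i + m) t = (fun j => (h j)`_m).
  by have [t ht et] := Vf_mono H (leq_addr m i) (hV m); exists t.
have [t ht] := choice ex.
pose M := (\max_j size (h j))%N.
exists (\sum_(m < M) t m) => j; rewrite itilde_sum.
have hM : (size (h j) <= M)%N by apply: (leq_bigmax j).
have -> : h j = \poly_(m < M) (h j)`_m.
  apply/polyP => m; rewrite coef_poly; case: ltnP => // le.
  by rewrite nth_default // (leq_trans hM).
rewrite poly_def mulr_sumr; apply: eq_bigr => m _; have [htm etm] := ht m.
by rewrite (itilde_hom _ htm) etm -scalerAr -exprD.
Qed.

(** The condition for r / x_0^k to have no terms of negative degree, that is, to lie in R~. *)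
Definition low (k : nat) (r : R) : Prop := forall i, (i < k)%N -> cf i r = 0.

Lemma lowD k r r' : low k r -> low k r' -> low k (r + r').
Proof. by move=> h h' i lt; rewrite (cfD H) h // h' // addr0. Qed.

Lemma low_homM d t k r : Rhom d t -> low k r -> low (d + k) (t * r).
Proof.
move=> ht hr i lt; have [le|lti] := leqP d i; last exact: (cfM_lt H _ ht lti).
by rewrite -(subnKC le) (cfM H _ _ ht) hr ?mulr0 //; lia.
Qed.

Lemma lowM a k r : low k r -> low k (a * r).
Proof.
move=> hr i lt; rewrite [a]Rhom_sum mulr_suml (cf_sum H) big1 // => d _.
apply: (low_homM (Rhom_hcomp d a) hr).
exact: leq_trans lt (leq_addl _ _).
Qed.

Lemma Kx0_div k r : Kx0 r -> low k r -> exists f, Kx0 f /\ r = x0 ^+ k * f.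
Proof.
move=> /(Kx0P H) /choice[c hc] lo; pose N := msize (repr r).
exists (\sum_(m < N) constR I (c (k + m)%N) * x0 ^+ m); split.
  apply/(Kx0P H) => i; rewrite (cf_poly H _ (fun m => c (k + m)%N)).
  by case: ltnP => _; [exists (c (k + i)%N) | exists 0; rewrite (constA_0 H)].
apply: (cf_eq H) => i; have [le|lt] := leqP k i; last first.
  by rewrite lo // (cfM_lt H _ (Rhom_x0X I k) lt).
rewrite -{2}(subnKC le) (cf_x0XM H) (cf_poly H _ (fun m => c (k + m)%N)) subnKC // hc.
case: ltnP => // lei; rewrite -hc (cf_ge H) //.
exact: leq_trans lei (leq_subr _ _).
Qed.

Definition in_Rt (q : Qh I) : Prop := exists r k, q = fx r k /\ low k r.

Lemma in_Qh_setT q : in_Qh [set: Rtilde p] q <-> in_Rt q.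
Proof.
have [r [k ->]] := Qh_fx H q; split.
  move=> [h _ /extends_fx eh]; exists r, k; split => // i lt.
  by apply: germsP => j; rewrite -(itilde_coef H) eh coefXnM lt.
move=> [r' [k' [-> lo]]].
exists (fun j => \poly_(m < msize (repr r')) cf (k' + m) r' j) => //.
apply/extends_fx => j; apply/polyP => i; rewrite coefXnM (itilde_coef H).
case: ltnP => [lt|le]; first by rewrite lo.
rewrite coef_poly subnKC //; case: ltnP => // lei.
by rewrite (cf_ge H) // (leq_trans lei) // leq_subr.
Qed.

Lemma in_Rt_sum (T : Type) (l : seq T) (F : T -> Qh I) :
  (forall i, in_Rt (F i)) -> in_Rt (\sum_(i <- l) F i).
Proof.
move=> hF; apply: big_ind => //.
  by exists 0, 0%N; split=> //; rewrite (fx0 H).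
move=> _ _ [r [k [-> lo]]] [r' [k' [-> lo']]].
exists (x0 ^+ k' * r + x0 ^+ k * r'), (k' + k)%N; split.
  by rewrite -(fxD H) (fxK H) [(k' + k)%N]addnC (fxK H).
apply: lowD; first exact: (low_homM (Rhom_x0X _ _)).
by rewrite addnC; apply: (low_homM (Rhom_x0X _ _)).
Qed.

Lemma in_RtM a q : in_Rt q -> in_Rt (fracQ a 1 * q).
Proof.
move=> [r [k [-> lo]]]; exists (a * r), k; split; last exact: lowM.
by rewrite -[fracQ a 1]/(fx a 0) (fxM H).
Qed.

Section WithTrace.
Variables (sigma : Qh I -> Qh I) (tr : A -> K^o).
Hypotheses (sigmaT : trace_map sigma) (trT : trace_of sigma tr).

(* sigma (f c R~) lies in K[x_0] for [f] in the conductor and [c] in the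
   complementary module, so a component of f c of negative degree would be
   orthogonal to A. *)
Lemma conductor_dedekind f c : in_Qh (conductor (p := p)) f -> dedekind_module sigma c ->
  in_Rt (f * c).
Proof.
have [b [k ->]] := Qh_fx H f; have [c' [m ->]] := Qh_fx H c.
move=> [h hF /extends_fx eh] [phi _ hphi].
exists (b * c'), (k + m)%N; split=> [|i lt]; first exact: (fxM H).
apply: (tr_nondegenerate H sigmaT trT) => a.
have [D /(_ D a (leqnn D))[t ht et]] := cf_surj H.
(* The conductor property is applied to the constant [a] of R~: f a is some [r] in R. *)
have [r hr] := hF (fun j => (a j)%:P).
have ebt : b * t = x0 ^+ (k + D) * r.
  apply: itilde_inj => j; rewrite !itildeM eh -hr itilde_x0X (itilde_hom _ ht) et.
  by rewrite -mul_polyC exprD -!mulrA; congr (_ * _); rewrite [RHS]mulrC -mulrA.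
(* As sigma(c r) = phi r has no denominator, x_0^m divides [rho tr (c' * r)]. *)
have := hphi (r) 0%N; rewrite -!/(fx _ _) (fxM H) (proj2 trT) => /(fx_eqP H).
rewrite expr0 mulr1 addn0 => erho.
have zero l : (l < m)%N -> tr (cf l (c' * r)) = 0.
  move=> ltl; apply: (constA_inj H).
  rewrite -(cf_rho H _ _ (proj1 trT)) erho mulrC (cfM_lt H _ (Rhom_x0X I m) ltl).
  by rewrite (constA_0 H).
have -> : cf i (b * c') * a = cf (D + i) (x0 ^+ (k + D) * (c' * r)).
  rewrite mulrCA -ebt (_ : c' * (b * t) = t * (b * c')); last by ring.
  by rewrite (cfM H _ _ ht) et mulrC.
have [le|lti] := leqP k i; last first.
  rewrite (cfM_lt H _ (Rhom_x0X I (k + D))) ?(Alin0 (proj1 trT)) //.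
  by rewrite addnC ltn_add2r.
rewrite (_ : (D + i = (k + D) + (i - k))%N); last by lia.
by rewrite (cf_x0XM H) zero //; lia.
Qed.

Lemma Rgr0 i : Rgr i (0 : R).
Proof. by case: i => m //=; apply: Rhom0. Qed.

(** The fraction is g T^(-i). Orthogonality of g to V_m for m < i makes [rho tr (t * r)] start in
    degree D + i, and dividing it by x_0^(D+i) defines phi, homogeneous of degree -i. *)
Lemma dedekind_fx g D t i : Rhom D t -> cf D t = g ->
  (forall m v, (m < i)%N -> Vf m v -> tr (g * v) = 0) ->
  dedekind_module sigma (fx t (D + i)).
Proof.
move=> ht et hg; have trl := proj1 trT.
have lo r : low (D + i) (rho tr (t * r)).
  move=> l lt; rewrite (cf_rho H _ _ trl).
  suff -> : tr (cf l (t * r)) = 0 by rewrite (constA_0 H).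
  have [le|ltl] := leqP D l; last by rewrite (cfM_lt H _ ht ltl) (Alin0 trl).
  rewrite -(subnKC le) (cfM H _ _ ht) et; apply: (hg (l - D)%N).
    by lia.
  by exists (hcomp (l - D) r); [exact: Rhom_hcomp | exact: cf_hcomp H _ _].
have ex r : exists f, Kx0 f /\ rho tr (t * r) = x0 ^+ (D + i) * f.
  by apply: Kx0_div (lo r); apply: (Kx0_rho H trl).
have [phi hphi] := choice ex.
have phiK r : Kx0 (phi r) by have [] := hphi r.
have {}hphi r : rho tr (t * r) = x0 ^+ (D + i) * phi r by have [] := hphi r.
have phi_eq r a : rho tr (t * r) = x0 ^+ (D + i) * a -> phi r = a.
  rewrite hphi => /eqP; rewrite -subr_eq0 -mulrBr => /eqP /(x0X_nzd H) /eqP.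
  by rewrite subr_eq0 => /eqP.
exists phi; last first.
  move=> r k; rewrite -!/(fx _ _) (fxM H) (proj2 trT) hphi.
  by rewrite (fxK H).
exists 1%N, (fun=> - i%:Z), (fun=> phi); split=> [_|r]; last by rewrite big_ord1.
split; first split => // a x y ha.
  apply: phi_eq; rewrite mulrDr (rhoD H trl) mulrCA (rhoKx0 H trl _ ha) !hphi.
  by rewrite mulrDr [a * (_ * _)]mulrCA.
have phi0 : phi 0 = 0.
  apply: phi_eq; rewrite !mulr0; apply: (cf_eq H) => l.
  by rewrite (cf_rho H _ _ trl) (cf0 H) (Alin0 trl) (constA_0 H).
case=> m r hr; last by rewrite [r]hr phi0; apply: Rgr0.
have cfphi l : (i + l)%N != m -> cf l (phi r) = 0.
  move=> ne; rewrite -(cf_x0XM H (D + i)) -hphi (cf_rho H _ _ trl).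
  rewrite (cf_hom H _ (RhomM ht hr)) -addnA eqn_add2l (negPf ne).
  by rewrite (Alin0 trl) (constA_0 H).
have [le|lt] := leqP i m.
  rewrite [_ + _](_ : _ = Posz (m - i)%N); last by rewrite subzn.
  rewrite /Rgr; suff -> : phi r = hcomp (m - i) (phi r) by apply: Rhom_hcomp.
  apply: (cf_eq H) => l; case: (eqVneq l (m - i)%N) => [->|ne]; first by rewrite (cf_hcomp H).
  rewrite (cf_hom H _ (Rhom_hcomp (m - i) _)) (negPf ne) cfphi //.
  by apply: contraNneq ne => <-; rewrite addKn.
(* For m < i the target degree m - i is negative, where R is zero. *)
suff -> : phi r = 0 by apply: Rgr0.
apply: (cf_eq0 H) => l; apply: cfphi; rewrite gtn_eqF //.
exact: leq_trans lt (leq_addr _ _).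
Qed.

End WithTrace.
End Conductor.

(** * The two inclusions *)

Section Product.
Variables (K : fieldType) (n : nat) (I : idealr {mpoly K[n.+1]}).
Variables (s : nat) (p : 'I_s -> projPoint I) (Ip : 'I_s -> idealr {mpoly K[n.+1]}).
Local Notation R := {ideal_quot I}.
Local Notation x0 := (x0 I).
Local Notation A := (germs p).
Local Notation cf := (@germ_coef K n I s p).
Local Notation it j := (itilde (p j)).
Hypothesis H : off_hyperplane p Ip.
Variables (sigma : Qh I -> Qh I) (tr : A -> K^o).
Hypotheses (sigmaT : trace_map sigma) (trT : trace_of sigma tr).

Lemma submod_prod_sub :
  submod_prod (in_Qh (conductor (p := p))) (dedekind_module sigma) `<=`
  in_Qh [set: Rtilde p].
Proof.
move=> _ [m [r [f [c [fc ->]]]]]; apply/(in_Qh_setT H); apply: (in_Rt_sum H) => i.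
apply: (in_RtM H); have [hf hc] := fc i.
exact: (conductor_dedekind H sigmaT trT).
Qed.

Lemma idem_idem j : idem p j * idem p j = idem p j.
Proof. by apply: germsP => k; rewrite germsM /idem; case: eqP => _; rewrite ?mulr1 ?mulr0. Qed.

Lemma submod_prod_sup : (forall j, local_generator tr j) ->
  in_Qh [set: Rtilde p] `<=`
  submod_prod (in_Qh (conductor (p := p))) (dedekind_module sigma).
Proof.
move=> gen q; have [r [k ->]] := Qh_fx H q; move=> [h _ /(extends_fx H) eh].
have [D hD] := cf_surj H; have {}hD a := hD D a (leqnn D).
have hE j : exists t, Rhom D t /\ cf D t = idem p j.
  by have [t ? ?] := hD (idem p j); exists t.
have [E {}hE] := choice hE.
have ER j : Rhom D (E j) by have [] := hE j.
have EA j : cf D (E j) = idem p j by have [] := hE j.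
(* The numerators over x_0^D of the idempotents add up to that of 1. *)
have sumE : \sum_j E j = x0 ^+ D.
  apply/eqP; rewrite -subr_eq0; apply/eqP; apply: (cf_inj H (d := D)).
    by apply: RhomB; [apply: Rhom_bigsum | exact: Rhom_x0X].
  rewrite (cfD H) (cfN H) (cf_sum H) (cf_x0X H) (eq_bigr _ (fun j _ => EA j)).
  by rewrite idem_sum subrr.
have ex j : exists fc : Qh I * Qh I, [/\ in_Qh (conductor (p := p)) fc.1,
    dedekind_module sigma fc.2 & fc.1 * fc.2 = fx r k * fx (E j) D].
  have [i [g [y [hV hg yg]]]] := gen j.
  have [t ht et] := hD g.
  pose z := idem p j * y.
  have zg : z * g = idem p j by rewrite -mulrA yg idem_idem.
  (* The conductor factor q e_j y T^i. *)
  pose F : Rtilde p := fun l => h l * (z l)%:P * 'X^i.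
  have hF : exists r', forall l, it l r' = 'X^D * F l.
    apply: (realize H) => m; set a : A := fun _ => _.
    by have [u hu eu] := hD a; exists u.
  have [b hb] := hF.
  exists (fx b D, fx t (D + i)); split => /=.
  - exists F; last by apply/(extends_fx H).
    (* Apart from T^i, all coefficients of F G are multiples of e_j, hence lie in V_i. *)
    move=> G; have [r' hr'] : exists r', forall l, it l r' = 'X^i * (h l * G l * (z l)%:P).
      apply: (realize H) => m.
      pose w : A := fun l => (h l * G l)`_m.
      set a : A := fun _ => _.
      have -> : a = idem p j * (w * y).
        by apply: germsP => l; rewrite /a coefMC !germsM /z germsM mulrCA.
      exact: hV.
    have swap (B : comNzRingType) (a b' c d : B) : a * b' * c * d = c * (a * d * b').
      by ring.
    by exists r' => l; rewrite hr' /F swap.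
  - exact: (dedekind_fx H trT ht et hg).
  - rewrite !(fxM H); apply/(fx_eqP H); apply: (itilde_inj H) => l.
    rewrite !(itildeM H) !(itilde_x0X H) hb eh (itilde_hom H _ ht) et.
    rewrite (itilde_hom H _ (ER j)) EA -zg germsM /F -!mul_polyC.
    rewrite (polyCM (z l) (g l)) !exprD.
    have swap (B : comNzRingType) (d h' z' i' g' k' : B) :
      d * (h' * z' * i') * (g' * d) * (k' * d) = k' * h' * (z' * g' * d) * (d * (d * i')).
      by ring.
    exact: swap.
have [fc hfc] := choice ex.
exists s, (fun=> 1), (fun j => (fc j).1), (fun j => (fc j).2); split.
  by move=> j; have [] := hfc j.
rewrite (eq_bigr (fun j => fx r k * fx (E j) D)) => [|j _].
  by rewrite -mulr_sumr -(fx_sum H) sumE (fx_xx H) mulr1.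
rewrite -[fracQ 1 1]/(fx (x0 ^+ 0) 0) (fx_xx H) mul1r.
by have [] := hfc j.
Qed.

End Product.

Theorem theorem5p7 (K : fieldType) (n : nat) (I : idealr {mpoly K[n.+1]})
    (s : nat) (p : 'I_s -> projPoint I) (Ip : 'I_s -> idealr {mpoly K[n.+1]})
    (sigma : Qh I -> Qh I) :
  homog_ideal I -> saturated I -> zero_dimensional I ->
  enumerates_support p ->
  (forall j, 'X_ord0 \notin p j) ->
  (forall j, gorenstein_local (localRing (p j))) ->
  trace_map sigma ->
  primary_components p Ip ->
  cayley_bacharach p \/ HF_condition p Ip ->
  submod_prod (in_Qh (conductor (p := p))) (dedekind_module sigma) =
    in_Qh [set: Rtilde p].
Proof.
move=> hI _ zd sup X0 _ sT pr cond; have H := OffHyperplane hI zd sup X0 pr.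
have [tr trT] := trace_of_exists H sT.
apply/seteqP; split; first exact: (submod_prod_sub H sT trT).
apply: (submod_prod_sup H trT) => j.
have nd := tr_nondegenerate H sT trT; have rep := tr_represents H sT trT.
case: cond => [CB|HFc]; first exact: (CB_local_generator H (proj1 trT) rep nd (CB j)).
exact: (HF_local_generator H (proj1 trT) rep nd j HFc).
Qed.
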